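(* Let $M$ be the Hardy-Littlewood maximal operator on $\mathbf{R}^n$. (1) If $1<s<\infty$, $0<p\le s$ and $-n\left(1-\frac ps\right)\le\alpha<n(p-1)$, then $M$ is of type $(BL^{p,s}_{|x|^\alpha},BL^{p,s}_{|x|^\alpha})$: there is a constant $C$ with $\|Mf\|_{BL^{p,s}_{|x|^\alpha}}\le C\|f\|_{BL^{p,s}_{|x|^\alpha}}$ for all $f\in BL^{p,s}_{|x|^\alpha}$. (2) If $1<s<\infty$, $0<p<s$, $-n\left(1-\frac ps\right)<\alpha<n(p-1)$ and $\alpha\le0$, then $M$ is of type $(BL^{p,s}_{|x|^\alpha},L^p_{|x|^\alpha})$: there is a constant $C$ with $\|Mf\|_{L^p_{|x|^\alpha}}\le C\|f\|_{BL^{p,s}_{|x|^\alpha}}$ for all $f\in BL^{p,s}_{|x|^\alpha}$.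
   Context: $Mf(x)=\sup_{x\in B}\frac1{|B|}\int_B|f(y)|\,dy$ for $f\in L^1_{loc}$, the supremum over balls $B$ containing $x$; $\|g\|_{L^p_{|x|^\alpha}}=\left(\int_{\mathbf{R}^n}|g(x)|^p|x|^\alpha dx\right)^{1/p}$. Blocks: for $\alpha\in\mathbf{R}$, $0<p<\infty$, $0<s\le\infty$, a function $a$ on $\mathbf{R}^n$ is a $(p,s,\alpha)$-block if there is a ball $B(x_0,r)=\{x:|x-x_0|\le r\}$ with $x_0\in\mathbf{R}^n$, $r>0$, such that $\operatorname{supp}a\subseteq B(x_0,r)$ and $\|a\|_{L^s}\le|B(x_0,r)|^{-\frac{\alpha}{pn}-\frac1p+\frac1s}$ ($|\cdot|$ is Lebesgue measure). Let $\bar p=\min\{p,1\}$. The space $BL^{p,s}_{|x|^\alpha}$ consists of all $f=\sum_{k}\lambda_ka_k$ (countable sum, convergence a.e.), where each $a_k$ is a $(p,s,\alpha)$-block and $\sum_k|\lambda_k|^{\bar p}<\infty$, with quasinorm $\|f\|_{BL^{p,s}_{|x|^\alpha}}=\inf\left(\sum_k|\lambda_k|^{\bar p}\right)^{1/\bar p}$, the infimum over all such decompositions. *)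

(* Defs.v *)
From HB Require Import structures.
From mathcomp Require Import all_boot all_order all_algebra.
From mathcomp Require Import all_classical all_reals all_analysis.

Set Implicit Arguments.
Unset Strict Implicit.
Unset Printing Implicit Defensive.
Import Order.TTheory GRing.Theory Num.Theory.
Import numFieldNormedType.Exports.

Local Open Scope classical_set_scope.
Local Open Scope ring_scope.
Local Open Scope ereal_scope.

(* The Euclidean space of dimension N >= 1 is 'rV[R]_n.+1 with N = n.+1. *)

Section lebesgue_measure_Rn.
Context {R : realType} (n : nat).
Implicit Types (a b : 'rV[R]_n.+1) (A : set 'rV[R]_n.+1).

Definition box a b : set 'rV[R]_n.+1 :=
  [set x | forall i, (a ord0 i < x ord0 i <= b ord0 i)%R].

Definition box_vol a b : R :=
  (\prod_i Num.max 0 (b ord0 i - a ord0 i))%R.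

Definition leb_outer A : \bar R :=
  ereal_inf [set \sum_(k <oo) (box_vol (c k).1 (c k).2)%:E |
    c in [set c : nat -> 'rV[R]_n.+1 * 'rV[R]_n.+1 |
      A `<=` \bigcup_k box (c k).1 (c k).2]].

Lemma box_vol_ge0 a b : (0 <= box_vol a b)%R.
Proof. by apply: prodr_ge0 => i _; rewrite le_max lexx. Qed.

Lemma leb_outer_ge0 A : 0 <= leb_outer A.
Proof.
apply: le_ereal_inf_tmp => x [c _ <-].
by apply: nneseries_ge0 => k _ _; rewrite lee_fin box_vol_ge0.
Qed.

Lemma leb_outer0 : leb_outer set0 = 0.
Proof.
apply/eqP; rewrite eq_le leb_outer_ge0 andbT.
apply: ereal_inf_lbound; exists (fun=> (0%R, 0%R)) => //.
apply: eseries0 => k _ _ /=.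
by rewrite /box_vol big_ord_recl !mxE subrr maxxx mul0r.
Qed.

Lemma le_leb_outer : {homo leb_outer : A B / A `<=` B >-> A <= B}.
Proof.
move=> A B AB; apply/ereal_inf_le_tmp => x [c cB <-].
by exists c => //; exact: subset_trans cB.
Qed.

Lemma leb_outer_sigma_subadditive : sigma_subadditive leb_outer.
Proof.
move=> A; have [[i ioo]|] := pselect (exists i, leb_outer (A i) = +oo).
  rewrite (eseries_pinfty _ _ ioo) ?leey// => k _.
  by rewrite -ltNye (lt_le_trans _ (leb_outer_ge0 _)).
rewrite -forallNE => Aoo.
suff add2e (e : {posnum R}) :
    leb_outer (\bigcup_k A k) <= \sum_(i <oo) leb_outer (A i) + e%:num%:E.
  by apply/lee_addgt0Pr => _/posnumP[].
rewrite (le_trans _ (epsilon_trick _ _ _))//; last first.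
  by move=> k; exact: leb_outer_ge0.
pose v (c : 'rV[R]_n.+1 * 'rV[R]_n.+1) := (box_vol c.1 c.2)%:E.
have v_ge0 c : 0 <= v c by rewrite lee_fin box_vol_ge0.
pose P k (c : nat -> 'rV[R]_n.+1 * 'rV[R]_n.+1) :=
  A k `<=` \bigcup_j box (c j).1 (c j).2 /\
  \sum_(j <oo) v (c j) <= leb_outer (A k) + (e%:num / (2 ^ k.+1)%:R)%:E.
have [G PG] : {G & forall k, P k (G k)}.
  apply: (@choice _ _ P) => k; rewrite /P.
  have fA : leb_outer (A k) \is a fin_num.
    by rewrite ge0_fin_numE ?leb_outer_ge0// ltey; exact/eqP/Aoo.
  have ek : (0 < e%:num / (2 ^ k.+1)%:R)%R by [].
  have [x [c Ac <-] xA] := lb_ereal_inf_adherent ek fA.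
  by exists c; split => //; exact/ltW.
have vG_ge0 x : 0 <= (v \o uncurry G) x by exact: v_ge0.
apply: (@le_trans _ _ (\esum_(i in setT) (v \o uncurry G) i)).
  apply: ereal_inf_lbound => /=.
  have /card_esym/ppcard_eqP[f] := card_nat2.
  exists (uncurry G \o f).
    move=> t [i _ Ait]; have [j _ Gijt] := (PG i).1 t Ait.
    by exists (f^-1%FUN (i, j)) => //=; rewrite invK ?inE.
  rewrite -(esum_pred_image (v \o uncurry G) _ xpredT) ?[fun=> _]set_true//.
  by rewrite image_eq.
rewrite (_ : esum _ _ = \sum_(i <oo) \sum_(j <oo) v (G i j)); last first.
  pose J : nat -> set (nat * nat) := fun i => [set (i, j) | j in setT].
  rewrite (_ : setT = \bigcup_k J k); last first.
    by rewrite predeqE => -[a b]; split => // _; exists a => //; exists b.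
  rewrite esum_bigcupT /=; last 2 first.
    - apply/trivIsetP => i j _ _ ij.
      rewrite predeqE => -[k m] /=; split => //= -[] [_] _ [<-{k} _].
      by move=> [m' _] [] /esym/eqP; rewrite (negbTE ij).
    - by move=> /= [k m]; exact: v_ge0.
  rewrite -(image_id [set: nat]) -fun_true esum_pred_image//; last first.
    by move=> k _; exact: esum_ge0.
  apply: eq_eseriesr => /= j _.
  rewrite -(esum_pred_image (v \o uncurry G) (pair j) predT)//=; last first.
    by move=> ? ? _ _; exact: (@can_inj _ _ _ snd).
  by congr esum; rewrite predeqE => -[a b]; split; move=> [i _ <-]; exists i.
apply: lee_lim.
- apply: is_cvg_nneseries => k *.
  by apply: nneseries_ge0 => m *; exact: (vG_ge0 (k, m)).
- by apply: is_cvg_nneseries => k *; apply: adde_ge0 => //;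
    exact: leb_outer_ge0.
- by near=> k; apply: lee_sum => i _; exact: (PG i).2.
Unshelve. all: by end_near. Qed.

HB.instance Definition _ := isOuterMeasure.Build R 'rV[R]_n.+1 leb_outer
  leb_outer0 leb_outer_ge0 le_leb_outer leb_outer_sigma_subadditive.

(* The Caratheodory sigma-algebra of leb_outer: Lebesgue (not merely Borel)
   measurable sets. *)
Local Notation Rn := (caratheodory_type leb_outer).

Definition leb : set Rn -> \bar R := leb_outer.

HB.instance Definition _ := isMeasure.Build _ Rn R leb
  (@caratheodory_measure0 _ _ leb_outer) (@caratheodory_measure_ge0 _ _ leb_outer)
  (@caratheodory_measure_sigma_additive _ _ leb_outer).

End lebesgue_measure_Rn.
Arguments leb {R n}.
Notation Rn R n := (caratheodory_type (@leb_outer R n)).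

Section block_spaces.
Context {R : realType} {n : nat}.
Implicit Types (c x : 'rV[R]_n.+1) (r p alpha : R) (s : \bar R).
Implicit Types (f g : 'rV[R]_n.+1 -> \bar R).

(* The library norm `|x| on row vectors is the sup norm. *)
Definition enorm x : R := Num.sqrt (\sum_i x ord0 i ^+ 2)%R.

Definition cball c r : set 'rV[R]_n.+1 := [set x | (enorm (x - c) <= r)%R].

Definition HL_max f x : \bar R :=
  ereal_sup [set (leb (cball B.1 B.2))^-1 * \int[leb]_(y in cball B.1 B.2) `|f y|
    | B in [set B : 'rV[R]_n.+1 * R | (0 < B.2)%R /\ cball B.1 B.2 x]].

(* At the single point x = 0 the weight powR 0 alpha is 0 for alpha != 0; this
   does not affect the integral. *)
Definition weighted_Lnorm p alpha g : \bar R :=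
  (\int[leb]_x (`|g x| `^ p * (enorm x `^ alpha)%:E)) `^ p^-1.

(* fine s^-1 is 1/s, with 1/s = 0 for s = +oo. *)
Definition block p s alpha (a : 'rV[R]_n.+1 -> R) : Prop :=
  measurable_fun [set: Rn R n] a /\
  exists c r, [/\ (0 < r)%R,
    closure [set x | a x != 0%R] `<=` cball c r &
    'N[leb]_s[EFin \o a] <=
      leb (cball c r) `^ (- (alpha / (p * n.+1%:R)) - p^-1 + fine s^-1)].

Definition pbar p : R := Num.min p 1%R.

(* Functions are extended-real valued because HL_max f may be infinite on a null
   set; the series itself converges in R almost everywhere. *)
Definition block_decomposition p s alpha f
    (lam : nat -> R) (a : nat -> 'rV[R]_n.+1 -> R) : Prop :=
  [/\ forall k, block p s alpha (a k),
      \sum_(k <oo) (`|lam k| `^ pbar p)%:E < +oo &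
      {ae (@leb R n), forall x, f x \is a fin_num /\
        ([series lam k * a k x]_k @ \oo --> fine (f x))%R}].

Definition BL p s alpha : set ('rV[R]_n.+1 -> \bar R) :=
  [set f | exists lam a, block_decomposition p s alpha f lam a].

(* Equal to +oo when f is not in BL p s alpha (ereal_inf of the empty set). *)
Definition BLnorm p s alpha f : \bar R :=
  ereal_inf [set z | exists lam a, block_decomposition p s alpha f lam a /\
    z = (\sum_(k <oo) (`|lam k| `^ pbar p)%:E) `^ (pbar p)^-1].

End block_spaces.

(* Main.v *)
Require Import Defs.
From HB Require Import structures.
From mathcomp Require Import all_boot all_order all_algebra.
From mathcomp Require Import all_classical all_reals all_analysis.
From mathcomp Require Import measurable_realfun ring lra.

(** Write [N = n.+1] and [theta = alpha / (p N) + 1 / p].  The size condition of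
    a block supported by a ball [B] says that its [L^s]-average over [B] is at
    most the height [|B| ^ - theta], and the two bounds on [alpha] say that
    [1 / s <= theta < 1], with a strict first inequality in the second part.

    The core is the maximal function of one nonnegative block [b] supported by a
    ball [B] of radius [r].  On the doubled ball its [L^s] norm is controlled by
    that of [b] ([HL_max_strong_type], deduced from the Vitali covering argument
    through the weak type inequality at dyadic levels).  At a distance at least
    [2 ^ j r] from the center, only balls whose radius is at least a multiple of
    [2 ^ j r] reach [B], so that the maximal function is at most a multiple of
    [2 ^ - (j N)] times the height of [b] ([HL_max_block_far]).  A block on
    [2 ^ j B] may have [2 ^ - (j N theta)] times that height.  Cut into dyadic
    annuli, the maximal function is therefore a series of blocks with
    coefficients comparable to [2 ^ - (j N (1 - theta))], a convergent geometric
    series as [theta < 1] ([HL_max_block_pieces]).  By countable subadditivity,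
    the maximal function of a block series with coefficients [lam k] is dominated
    by a series of nonnegative blocks whose coefficients have an [l^pbar]
    quasinorm bounded by that of [lam] ([HL_max_block_series]).

    For the first part, it remains to see that a nonnegative function dominated
    by such a series is itself a block series with the same coefficients
    ([block_decomposition_dominated]): multiply every term by the ratio of the
    function to the sum.  The sum is finite almost everywhere because blocks are
    uniformly bounded in [L^1] of every ball around the origin, which for large
    blocks uses [1 / s <= theta] and for small ones [theta <= 1]
    ([nonneg_block_locally_bounded]).

    For the second part, nonnegative blocks are uniformly bounded in the weighted
    space ([nonneg_block_weighted_le]): by Young's inequality this reduces to
    bounding the averages of a power [|x| ^ beta] with [- N < beta <= 0] over
    balls.  Series are then summed by the subadditivity of [t ^ p] if [p <= 1]
    and by Jensen's inequality if [1 < p] ([nonneg_block_series_weighted_le]).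

    All this rests on the formula [|B| = unit_ball_vol * r ^ N], with a constant
    that is finite and positive ([leb_cball]).  Translations and dilations act
    on covers by boxes; positivity is the fact that boxes that cover the unit box
    have total volume at least 1 ([box_cover_slicing]). *)

Set Implicit Arguments.
Unset Strict Implicit.
Unset Printing Implicit Defensive.
Import Order.TTheory GRing.Theory Num.Theory.
Import numFieldNormedType.Exports.
Local Open Scope classical_set_scope.
Local Open Scope ring_scope.

(** * Powers and series *)

Lemma powRD_gt0 (R : realType) (x r s : R) : 0 < x ->
  x `^ (r + s) = x `^ r * x `^ s.
Proof. by move=> x0; rewrite powRD// (gt_eqF x0) implybT. Qed.

Lemma powR_inv (R : realType) (x r : R) : 0 <= x -> x^-1 `^ r = x `^ (- r).
Proof. by move=> x0; rewrite -(powR_inv1 x0) -powRrM mulN1r. Qed.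

Lemma powR_exprn (R : realType) (x q : R) j : 0 <= x ->
  (x ^+ j) `^ q = (x `^ q) ^+ j.
Proof.
move=> x0; elim: j => [|j ih]; first by rewrite !expr0 powR1.
by rewrite !exprS powRM ?exprn_ge0// ih.
Qed.

Lemma powR_le1 (R : realType) (a e : R) : 1 <= a -> e <= 0 -> a `^ e <= 1.
Proof. by move=> a1 e0; have := ler_powR a1 e0; rewrite powRr0. Qed.

Lemma ge0_ler_powR_neg (R : realType) (a b e : R) :
  0 < a -> a <= b -> e <= 0 -> b `^ e <= a `^ e.
Proof.
move=> a0 ab e0; have b0 : 0 < b by exact: lt_le_trans ab.
rewrite -[e]opprK !(powRN _ (- e)) lef_pV2 ?posrE ?powR_gt0//.
by apply: ge0_ler_powR; rewrite ?oppr_ge0 ?nnegrE ?(ltW a0) ?(ltW b0).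
Qed.

Lemma le_poweR (R : realType) (r : R) (x y : \bar R) : 0 <= r -> (0 <= x)%E ->
  (x <= y)%E -> (x `^ r <= y `^ r)%E.
Proof.
move=> r0 x0 xy; apply: gt0_ler_poweR => //; rewrite in_itv/= ?x0 leey//.
by rewrite (le_trans x0).
Qed.

Lemma nneseries_ge_term (R : realType) (u : nat -> \bar R) k :
  (forall i, 0 <= u i)%E -> (u k <= \sum_(i <oo) u i)%E.
Proof.
move=> u0; apply: le_trans (nneseries_lim_ge k.+1 _); last by move=> i _ _.
by rewrite big_nat_recr//= leeDr// sume_ge0.
Qed.

Lemma nneseries_geometric (R : realType) (z : R) : 0 <= z -> z < 1 ->
  (\sum_(k <oo) (z ^+ k)%:E = (1 - z)^-1%:E)%E.
Proof.
move=> z0 z1; have cv : series (geometric 1 z) @ \oo --> 1 * (1 - z)^-1.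
  by apply: cvg_geometric_series; rewrite ger0_norm.
rewrite mul1r in cv; apply/cvg_lim => //.
rewrite (_ : (fun m => _) = (fun m => (series (geometric 1 z) m)%:E)).
  by apply: cvg_EFin; [exact: nearW|exact: cv].
by apply/funext => m; rewrite sumEFin /series/=; under [in RHS]eq_bigr do rewrite mul1r.
Qed.

(** Every block of a series contributes a series of blocks to the maximal
    function; this turns the double series into a series. *)
Lemma nneseries_pairing (R : realType) : exists phi : nat -> nat * nat,
  forall u : nat -> nat -> \bar R, (forall k j, 0 <= u k j)%E ->
  (\sum_(i <oo) u (phi i).1 (phi i).2 = \sum_(k <oo) \sum_(j <oo) u k j)%E.
Proof.
have /card_esym/ppcard_eqP[phi] := card_nat2.
exists phi => u u0; rewrite nneseries_esumT//.
rewrite nneseries_esumT; last by move=> k; apply: nneseries_ge0 => j _ _.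
rewrite [RHS](eq_esum (b := fun k => \esum_(j in [set: nat]) u k j)); last first.
  by move=> k _; rewrite nneseries_esumT.
rewrite esum_esum//.
rewrite (_ : setT `*`` _ = [set: nat * nat]); last by apply/seteqP; split.
have bij : set_bij [set: nat] [set: nat * nat] phi by split.
by rewrite (@reindex_esum R _ _ _ _ phi (fun z => u z.1 z.2) bij).
Qed.

(** For [q <= 1] the [l^1] norm is at most the [l^q] norm [T]: every term is at
    most [T], so that [y_k <= y_k ^ q T ^ (1 - q)]. *)
Lemma nneseries_le_powR (R : realType) (q : R) (y : nat -> \bar R) :
  0 < q -> q <= 1 ->
  (forall k, 0 <= y k)%E ->
  (\sum_(k <oo) y k <= (\sum_(k <oo) y k `^ q) `^ q^-1)%E.
Proof.
move=> q0 q1 y0; set S := (\sum_(k <oo) y k `^ q)%E.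
have q_neq0 : q != 0 by rewrite gt_eqF.
have S0 : (0 <= S)%E by apply: nneseries_ge0 => k _ _; exact: poweR_ge0.
have yS k : (y k `^ q <= S)%E.
  by apply: (@nneseries_ge_term _ (fun k => y k `^ q)%E) => i; exact: poweR_ge0.
case SE : S S0 yS => [sg| |]// S0 yS; last by rewrite poweRyr ?invr_eq0// leey.
rewrite lee_fin in S0.
pose C := sg `^ ((1 - q) / q).
have -> : (sg%:E `^ q^-1 = C%:E * S)%E.
  rewrite SE poweR_EFin -EFinM; congr _%:E.
  have [->|sg0] := eqVneq sg 0; first by rewrite mulr0 powR0 ?invr_eq0.
  rewrite /C -[X in _ = _ * X](powRr1 S0) -powRD_gt0 ?lt_def ?sg0//.
  by congr (_ `^ _); field.
rewrite /S -nneseriesZl; last by move=> k _; exact: poweR_ge0.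
apply: lee_nneseries => [k _ _|k _]; first exact: y0.
case: (y k) (y0 k) (yS k) => [t| |]//; last by rewrite poweRyr.
rewrite poweR_EFin !lee_fin => t0 ts.
have tE : t = (t `^ q) `^ ((1 - q) / q) * t `^ q.
  have [->|tn0] := eqVneq t 0; first by rewrite [_ `^ q]powR0 ?mulr0.
  rewrite -powRrM [q * _]mulrC divfK// -powRD_gt0 ?lt_def ?tn0//.
  by rewrite subrK powRr1.
rewrite {1}tE; apply: ler_wpM2r; first exact: powR_ge0.
apply: ge0_ler_powR; rewrite ?nnegrE ?powR_ge0//.
by rewrite divr_ge0 ?subr_ge0// ltW.
Qed.

Lemma summable_of_powR (R : realType) (q : R) (mu : nat -> R) :
  0 < q -> q <= 1 ->
  (forall k, 0 <= mu k) -> (\sum_(k <oo) (mu k `^ q)%:E < +oo)%E ->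
  (\sum_(k <oo) (mu k)%:E < +oo)%E.
Proof.
move=> q0 q1 mu0 smu.
apply: le_lt_trans (@nneseries_le_powR R q (fun k => (mu k)%:E) q0 q1 _) _ => //.
exact: poweR_lty.
Qed.

(** Jensen's inequality for a countable sum, obtained by adding up Young's
    inequality [b_k t ^ (p - 1) <= b_k ^ p / p + t ^ p (1 - 1 / p)] at the
    mean value [t] of the [b_k]. *)
Lemma nneseries_jensen (R : realType) (p : R) (mu : nat -> R)
    (b : nat -> \bar R) (L : R) : 1 < p ->
  (forall k, 0 <= mu k) -> (forall k, 0 <= b k)%E ->
  (\sum_(k <oo) (mu k)%:E = L%:E)%E ->
  ((\sum_(k <oo) (mu k)%:E * b k) `^ p <=
    (L `^ (p - 1))%:E * \sum_(k <oo) (mu k)%:E * b k `^ p)%E.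
Proof.
move=> p1 mu0 b0 muL; have p0 : 0 < p by exact: lt_trans p1.
have L0 : 0 <= L.
  by rewrite -lee_fin -muL; apply: nneseries_ge0 => k _ _; rewrite lee_fin.
set S := (\sum_(k <oo) (mu k)%:E * b k)%E.
set Q := (\sum_(k <oo) (mu k)%:E * b k `^ p)%E.
have mub0 k : (0 <= (mu k)%:E * b k)%E by rewrite mule_ge0 ?lee_fin.
have mubp0 k : (0 <= (mu k)%:E * b k `^ p)%E by rewrite mule_ge0 ?lee_fin ?poweR_ge0.
have S0 : (0 <= S)%E by exact: nneseries_ge0.
have Q0 : (0 <= Q)%E by exact: nneseries_ge0.
have [L_eq0|Lneq0] := eqVneq L 0.
  have mu_eq0 k : mu k = 0.
    apply/eqP; rewrite eq_le mu0 andbT -lee_fin -L_eq0 -muL.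
    by apply: (@nneseries_ge_term _ (fun k => (mu k)%:E)) => i; rewrite lee_fin.
  rewrite {1}/S eseries0; last by move=> k _ _; rewrite mu_eq0 mul0e.
  by rewrite poweR0r ?gt_eqF// mule_ge0// lee_fin powR_ge0.
have {Lneq0} L0 : 0 < L by rewrite lt_def Lneq0.
have young t : 0 <= t -> ((t `^ (p - 1))%:E * S <=
    p^-1%:E * Q + (t `^ p * (1 - p^-1) * L)%:E)%E.
  move=> t0; have e0 : 0 <= 1 - p^-1 by rewrite subr_ge0 invf_le1// ltW.
  rewrite /S -nneseriesZl// /Q -nneseriesZl//.
  rewrite [(_ * L)%:E]EFinM -muL -nneseriesZl; last by move=> k _; rewrite lee_fin.
  rewrite -nneseriesD => [|k _|k _]; last 2 first.
  - by rewrite mule_ge0// lee_fin invr_ge0 ltW.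
  - by rewrite -EFinM lee_fin !mulr_ge0 ?powR_ge0.
  apply: lee_nneseries => [k _ _|k _]; first by rewrite mule_ge0// lee_fin powR_ge0.
  rewrite muleCA [(p^-1%:E * _)%E]muleCA [X in (_ <= _ + X)%E]muleC -ge0_muleDr;
      last 2 first.
  - by rewrite mule_ge0 ?poweR_ge0// lee_fin invr_ge0 ltW.
  - by rewrite lee_fin mulr_ge0 ?powR_ge0.
  apply: lee_wpmul2l; first by rewrite lee_fin.
  case: (b k) (b0 k) => [y| |]// y0; last first.
    rewrite [(+oo `^ p)%E]poweRyr ?gt_eqF//
      [(p^-1%:E * +oo)%E]gt0_muley ?lte_fin ?invr_gt0//.
    by rewrite addye// leey.
  rewrite lee_fin in y0; rewrite poweR_EFin -!EFinM -EFinD lee_fin.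
  pose q := (1 - p^-1)^-1.
  have q0 : 0 < q by rewrite invr_gt0 subr_gt0 invf_lt1.
  have conj : p^-1 + q^-1 = 1 by rewrite /q invrK addrC subrK.
  have := conjugate_powR y0 (powR_ge0 t (p - 1)) p0 q0 conj.
  rewrite -[(t `^ (p - 1)) `^ q]powRrM (_ : (p - 1) * q = p); last first.
    by rewrite /q; field; rewrite gt_eqF//= subr_eq0 gt_eqF.
  by rewrite /q invrK mulrC [_^-1 * _]mulrC.
case QE : Q Q0 => [Qr| |]// Q0; last first.
  by rewrite gt0_muley ?leey// lte_fin powR_gt0.
have Sfin : S \is a fin_num.
  rewrite ge0_fin_numE//; have := young 1 ler01; rewrite powR1 mul1e => /le_lt_trans;
      apply.
  by rewrite QE -EFinM -EFinD ltry.
rewrite lee_fin in Q0.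
case SE : S Sfin S0 => [Sr| |]// _ S0; rewrite lee_fin in S0.
rewrite poweR_EFin -EFinM lee_fin.
pose t := Sr / L; have t0 : 0 <= t by rewrite divr_ge0// ltW.
have := young t t0; rewrite QE SE -!EFinM -EFinD lee_fin.
have -> : Sr = t * L by rewrite /t divfK ?gt_eqF.
rewrite mulrCA mulrA mulr_powRB1// => H.
have {}H : t `^ p * L <= Qr.
  have : t `^ p * L * p^-1 <= Qr * p^-1 by lra.
  by rewrite ler_pM2r// invr_gt0.
rewrite powRM// ?(ltW L0)// -(mulr_powRB1 (ltW L0) p0) mulrA mulrC.
by apply: ler_wpM2l => //; exact: powR_ge0.
Qed.

(** The sum of a geometric progression with ratio [2 ^ (s - 1)] is at most this
    multiple of its last term. *)
Definition dyadic_ratio {R : realType} (s : R) : R :=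
  2 `^ (s - 1) / (2 `^ (s - 1) - 1).

Lemma dyadic_ratio_gt0 (R : realType) (s : R) : 1 < s -> 0 < dyadic_ratio s.
Proof.
move=> s1; rewrite divr_gt0 ?powR_gt0// subr_gt0.
have := @gt0_ltr_powR R (s - 1) _ 1 2; rewrite powR1; apply.
- by rewrite subr_gt0.
- by rewrite nnegrE.
- by rewrite nnegrE.
- by rewrite ltr1n.
Qed.

Lemma dyadic_sum_le (R : realType) (s t Y : R) m : 1 < s -> 0 < t -> 0 <= Y ->
  \sum_(j < m) (t * 2 ^+ j) `^ (s - 1) * (t * 2 ^+ j < Y)%R%:R <=
  dyadic_ratio s * Y `^ (s - 1).
Proof.
move=> s1 t0 Y0; have := dyadic_ratio_gt0 s1; rewrite /dyadic_ratio.
set d := 2 `^ (s - 1) => D0.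
have d0 : 0 < d by exact: powR_gt0.
have d1 : 1 < d by move: D0; rewrite pmulr_rgt0// invr_gt0 subr_gt0.
move/ltW in D0.
pose u j := (t * 2 ^+ j) `^ (s - 1).
have uS j : u j.+1 = d * u j.
  have tj : 0 <= t * 2 ^+ j by rewrite mulr_ge0 ?exprn_ge0// ltW.
  by rewrite /u /d -powRM// exprS mulrCA.
have sum_u k : \sum_(j < k.+1) u j <= d / (d - 1) * u k.
  elim: k => [|k ihk]; rewrite big_ord_recr/=.
    rewrite big_ord0 add0r ler_peMl ?powR_ge0// ler_pdivlMr ?subr_gt0// mul1r.
    by rewrite lerBlDr lerDl.
  apply: (le_trans (lerD ihk (lexx _))); rewrite uS.
  rewrite [leLHS](_ : _ = d / (d - 1) * (d * u k))//.
  by field; rewrite subr_eq0 gt_eqF.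
elim: m => [|m ih]; first by rewrite big_ord0 mulr_ge0// powR_ge0.
have [tY|tY] := ltP (t * 2 ^+ m) Y; last first.
  by rewrite big_ord_recr/= ltNge tY mulr0 addr0.
apply: (@le_trans _ _ (\sum_(j < m.+1) u j)).
  by apply: ler_sum => j _; rewrite ler_piMr ?powR_ge0//; case: (_ < _); rewrite ?ler01.
apply: (le_trans (sum_u m)); apply: ler_wpM2l => //.
apply: ge0_ler_powR; rewrite ?nnegrE ?subr_ge0//; [exact: ltW| |exact: ltW].
by rewrite mulr_ge0 ?exprn_ge0// ltW.
Qed.

(** A discretized layer cake formula: if [t < y], the term of the largest level
    [t 2 ^ j] below [y] alone is at least [y ^ s]; if [y] is infinite, every level
    is below it and the terms are unbounded. *)
Lemma poweR_le_dyadic_levels (R : realType) (s t : R) (y : \bar R) :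
  1 < s -> 0 < t -> (0 <= y)%E ->
  (y `^ s <= (t `^ s)%:E + \sum_(j <oo)
     ((t * 2 ^+ j.+1) `^ s)%:E * ((t * 2 ^+ j)%:E < y)%E%:R%:E)%E.
Proof.
move=> s1 t0 y0; have s0 : 0 < s by exact: lt_trans s1.
have c0 j : (0 <= ((t * 2 ^+ j.+1) `^ s)%:E * ((t * 2 ^+ j)%:E < y)%E%:R%:E)%E.
  by rewrite mule_ge0// lee_fin ?powR_ge0.
have c_le j : ((t * 2 ^+ j)%:E < y)%E -> (((t * 2 ^+ j.+1) `^ s)%:E <= \sum_(j <oo)
     ((t * 2 ^+ j.+1) `^ s)%:E * ((t * 2 ^+ j)%:E < y)%E%:R%:E)%E.
  by move=> jy; apply: le_trans (nneseries_ge_term j c0); rewrite jy mule1.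
have large (z : R) : exists j, z <= t * 2 ^+ j.
  exists (Num.bound `|z / t|); rewrite mulrC -ler_pdivrMr//.
  apply: (le_trans (ler_norm _)).
  apply: (le_trans (ltW (archi_boundP (normr_ge0 _)))).
  by rewrite -natrX ler_nat ltnW// ltn_expl.
case: y y0 c0 c_le => [y| |]// y0 c0 c_le; last first.
  rewrite (_ : (\sum_(j <oo) _)%E = +oo%E) ?addey ?leey//.
  apply: eq_infty => z; have [j zj] := large (Num.max 1 z).
  apply: le_trans (c_le j (ltry _)); rewrite lee_fin.
  have := zj; rewrite ge_max => /andP[j1 zj'].
  have jS : t * 2 ^+ j <= t * 2 ^+ j.+1.
    by rewrite ler_pM2l// ler_eXn2l// ltr1n.
  apply: (le_trans (le_trans zj' jS)); apply: le1r_powR; last exact: ltW.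
  exact: le_trans jS.
have [yt|ty] := leP y t.
  rewrite -[leLHS]adde0; apply: leeD; last exact: nneseries_ge0.
  by rewrite poweR_EFin lee_fin ge0_ler_powR// ?nnegrE ltW.
have [k yk kmin] := ex_minnP (large y).
case: k yk kmin => [|k] yk kmin.
  by move: yk; rewrite expr0 mulr1 leNgt ty.
have ky : t * 2 ^+ k < y by rewrite ltNge; apply/negP => /kmin; rewrite ltnn.
rewrite -[leLHS]add0e; apply: leeD; first by rewrite lee_fin powR_ge0.
apply: le_trans (c_le k _); rewrite ?lte_fin// poweR_EFin lee_fin.
by apply: ge0_ler_powR; rewrite ?nnegrE// ltW// mulr_gt0// exprn_gt0.
Qed.

(** * Integration of globally measurable functions *)

(** All functions integrated below are measurable on the whole space, while the
    domains of integration are balls and annuli.  Stating the measurability of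
    the integrands over [setT] separates it from the choice of the domain. *)
Section globally_measurable.
Context d (T : measurableType d) (R : realType) (mu : {measure set T -> \bar R}).

Lemma ge0_le_integralT (D : set T) (f g : T -> \bar R) : measurable D ->
  measurable_fun setT f -> measurable_fun setT g ->
  (forall x, D x -> 0 <= f x)%E -> (forall x, D x -> f x <= g x)%E ->
  (\int[mu]_(x in D) f x <= \int[mu]_(x in D) g x)%E.
Proof.
by move=> mD mf mg f0 fg; apply: ge0_le_integral => //; exact: measurable_funTS.
Qed.

Lemma ge0_integralDT (D : set T) (f g : T -> \bar R) : measurable D ->
  measurable_fun setT f -> measurable_fun setT g ->
  (forall x, 0 <= f x)%E -> (forall x, 0 <= g x)%E ->
  (\int[mu]_(x in D) (f x + g x) = \int[mu]_(x in D) f x + \int[mu]_(x in D) g x)%E.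
Proof.
by move=> mD mf mg f0 fg; apply: ge0_integralD => //; exact: measurable_funTS.
Qed.

Lemma ge0_subset_integralT (A B : set T) (f : T -> \bar R) :
  measurable A -> measurable B -> measurable_fun setT f ->
  (forall x, 0 <= f x)%E -> A `<=` B ->
  (\int[mu]_(x in A) f x <= \int[mu]_(x in B) f x)%E.
Proof.
by move=> mA mB mf f0 AB; apply: ge0_subset_integral => //; exact: measurable_funTS.
Qed.

Lemma integral_nneseriesT (D : set T) (f : nat -> T -> \bar R) : measurable D ->
  (forall k, measurable_fun setT (f k)) -> (forall k x, 0 <= f k x)%E ->
  (\int[mu]_(x in D) (\sum_(k <oo) f k x) = \sum_(k <oo) \int[mu]_(x in D) f k x)%E.
Proof.
by move=> mD mf f0; apply: integral_nneseries => // k; exact: measurable_funTS.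
Qed.

Lemma ge0_integralZlT (D : set T) (f : T -> \bar R) (k : R) : measurable D ->
  measurable_fun setT f -> (forall x, 0 <= f x)%E -> 0 <= k ->
  (\int[mu]_(x in D) (k%:E * f x) = k%:E * \int[mu]_(x in D) f x)%E.
Proof.
by move=> mD mf f0 k0; apply: ge0_integralZl_EFin => //; exact: measurable_funTS.
Qed.

Lemma ge0_emeasurable_sumT (f : nat -> T -> \bar R) :
  (forall k, measurable_fun setT (f k)) -> (forall k x, 0 <= f k x)%E ->
  measurable_fun setT (fun x => \sum_(k <oo) f k x)%E.
Proof. by move=> mf f0; apply: ge0_emeasurable_sum. Qed.

Lemma emeasurable_funZl (f : T -> \bar R) (k : \bar R) :
  measurable_fun setT f -> measurable_fun setT (fun x => k * f x)%E.
Proof. by move=> mf; apply: emeasurable_funM => //; exact: measurable_cst. Qed.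

Lemma measurable_fun_poweR (f : T -> \bar R) (p : R) :
  measurable_fun setT f -> measurable_fun setT (fun x => f x `^ p)%E.
Proof. by move=> mf; exact: (measurableT_comp (measurable_poweR p) mf). Qed.

Lemma measurable_fun_abse (f : T -> \bar R) :
  measurable_fun setT f -> measurable_fun setT (fun x => `|f x|)%E.
Proof. by move=> mf; exact: measurableT_comp. Qed.

Lemma measurable_lt_ereal (f : T -> \bar R) (y : \bar R) :
  measurable_fun setT f -> measurable [set x | (y < f x)%E].
Proof.
by move=> mf; have := emeasurable_fun_o_infty measurableT mf y; rewrite setTI.
Qed.

Lemma measurable_fun_restrict (f : T -> \bar R) (D : set T) : measurable D ->
  measurable_fun setT f -> measurable_fun setT (f \_ D).
Proof. by move=> mD mf; apply/(measurable_restrictT _ mD); exact: measurable_funTS. Qed.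

Lemma measurable_fun_normE (a : T -> R) :
  measurable_fun setT a -> measurable_fun setT (fun x => `|a x|%:E).
Proof. by move=> ma; apply/measurable_EFinP; exact: measurableT_comp. Qed.

Lemma measurable_fun_powR (a : T -> R) (p : R) :
  measurable_fun setT a -> measurable_fun setT (fun x => a x `^ p).
Proof. by move=> ma; exact: (measurableT_comp (@measurable_powR R p) ma). Qed.

Lemma measurable_fun_fine (f : T -> \bar R) :
  measurable_fun setT f -> measurable_fun setT (fun x => fine (f x)).
Proof. by move=> mf; exact: (measurableT_comp (fine_measurable measurableT) mf). Qed.

End globally_measurable.

(** * Volumes of boxes and balls *)

(** A cover of the unit box by boxes has total volume at least 1, which makes the
    Lebesgue measure nontrivial.  The bound is obtained by integrating the
    multiplicity of the cover one coordinate at a time with the one-dimensional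
    Lebesgue measure; the weights [w k] accumulate the sides of the boxes that
    are already integrated. *)
Lemma box_cover_slicing (R : realType) m (w : nat -> R) (a b : nat -> nat -> R) :
  (forall k, 0 <= w k) ->
  (forall x : nat -> R, (forall i, 0 < x i <= 1) ->
    (1 <= \sum_(k <oo)
       (w k * \prod_(i < m) \1_`]a k i, b k i] (x i))%:E)%E) ->
  (1 <= \sum_(k <oo) (w k * \prod_(i < m) Num.max 0 (b k i - a k i))%:E)%E.
Proof.
elim: m w => [w w0 /(_ (fun=> 1))|m ih w w0 cov].
  under eq_eseriesr do rewrite big_ord0.
  under [in X in _ -> X]eq_eseriesr do rewrite big_ord0.
  by apply=> i; rewrite ltr01 lexx.
pose v k := w k * Num.max 0 (b k m - a k m).
have v0 k : 0 <= v k by rewrite mulr_ge0// le_max lexx.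
rewrite (eq_eseriesr (g := fun k =>
    (v k * \prod_(i < m) Num.max 0 (b k i - a k i))%:E)); last first.
  by move=> k _; rewrite big_ord_recr/= /v mulrAC mulrA.
apply: ih => // x x01.
pose P k := w k * \prod_(i < m) \1_`]a k i, b k i] (x i).
have P0 k : 0 <= P k by rewrite mulr_ge0// prodr_ge0.
pose mu : {measure set (measurableTypeR R) -> \bar R} := @lebesgue_measure R.
have muI (u t : R) : mu `]u, t]%classic = (Num.max 0 (t - u))%:E.
  rewrite [LHS]lebesgue_measure_itv/= lte_fin -EFinD; case: ifPn => [ut|].
    by rewrite max_r// subr_ge0 ltW.
  by rewrite -leNgt => tu; rewrite max_l// subr_le0.
pose D : set R := `]0, 1]%classic.
have mD : measurable D by exact: measurable_itv.
have -> : 1%E = (\int[mu]_(t in D) 1)%E.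
  by rewrite integral_cst// mul1e muI subr0 max_r.
have mI k : measurable_fun D (fun t : R => (P k * \1_`]a k m, b k m] t)%:E : \bar R).
  apply/measurable_EFinP; apply: measurable_funM; first exact: measurable_cst.
  exact: (@measurable_indic _ _ R D `]a k m, b k m]%classic (measurable_itv _)).
apply: (@le_trans _ _ (\int[mu]_(t in D)
    (\sum_(k <oo) (P k * \1_`]a k m, b k m] t)%:E))%E).
  apply: ge0_le_integral => //.
  - by apply: ge0_emeasurable_sum => [k t _ _|k _]; [rewrite lee_fin mulr_ge0|
      exact: mI].
  - move=> t; rewrite /D/= in_itv/= => t01.
    have /cov : forall i, 0 < (if (i < m)%N then x i else t) <= 1.
      by move=> i; case: ifP.
    move/le_trans; apply; apply: lee_nneseries => [k _ _|k _].
      by rewrite lee_fin mulr_ge0// prodr_ge0.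
    rewrite big_ord_recr/= ltnn mulrA lee_fin /P.
    by under eq_bigr do rewrite ltn_ord.
rewrite integral_nneseries//; last by move=> k t _; rewrite lee_fin mulr_ge0.
apply: lee_nneseries => [k _ _|k _].
  by apply: integral_ge0 => t _; rewrite lee_fin mulr_ge0.
under eq_integral do rewrite EFinM.
rewrite ge0_integralZl_EFin//; last first.
  by apply/measurable_EFinP/measurable_indic; exact: measurable_itv.
rewrite integral_indic; [|exact: mD|exact: (measurable_itv `]a k m, b k m])].
apply: (@le_trans _ _ ((P k)%:E * mu `]a k m, b k m]%classic)%E).
  apply: lee_wpmul2l; rewrite ?lee_fin//.
  apply: le_measure; rewrite ?inE; [|exact: measurable_itv|exact: subIsetl].
  by apply: measurableI => //; exact: measurable_itv.
by rewrite muI -EFinM lee_fin /P /v mulrAC.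
Qed.

Section euclidean_geometry.
Context {R : realType} {n : nat}.
Implicit Types (c x y : 'rV[R]_n.+1) (r : R).
Local Notation N := n.+1.

Lemma enorm_ge0 x : 0 <= enorm x.
Proof. exact: sqrtr_ge0. Qed.

Lemma sqr_enorm x : enorm x ^+ 2 = \sum_i x ord0 i ^+ 2.
Proof. by rewrite sqr_sqrtr// sumr_ge0// => i _; rewrite sqr_ge0. Qed.

Lemma enorm0 : enorm (0 : 'rV[R]_N) = 0.
Proof. by rewrite /enorm big1 ?sqrtr0// => i _; rewrite mxE expr0n. Qed.

Lemma enormN x : enorm (- x) = enorm x.
Proof. by rewrite /enorm; under eq_bigr do rewrite mxE sqrrN. Qed.

Lemma enormZ (a : R) x : enorm (a *: x) = `|a| * enorm x.
Proof.
rewrite /enorm; under eq_bigr do rewrite mxE exprMn.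
by rewrite -mulr_sumr sqrtrM ?sqr_ge0// sqrtr_sqr.
Qed.

Lemma coord_le_enorm x i : `|x ord0 i| <= enorm x.
Proof.
rewrite -sqrtr_sqr ler_wsqrtr// (bigD1 i)//= lerDl sumr_ge0// => j _.
exact: sqr_ge0.
Qed.

Lemma enorm_le_coord x r : 0 <= r -> (forall i, `|x ord0 i| <= r) ->
  enorm x <= N%:R * r.
Proof.
move=> r0 xr; rewrite -[leRHS]ger0_norm ?mulr_ge0// -sqrtr_sqr ler_wsqrtr//.
apply: (@le_trans _ _ (\sum_(i < N) r ^+ 2)).
  by apply: ler_sum => i _; rewrite -[x _ _ ^+ 2]real_normK
      ?num_real// lerXn2r// nnegrE.
rewrite sumr_const card_ord exprMn -[leLHS]mulr_natl ler_wpM2r ?sqr_ge0//.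
by rewrite -natrX ler_nat (@leq_pexp2l N 1 2).
Qed.

(** After squaring this is the Cauchy-Schwarz inequality, the sum over [i] of
    [2 x_i y_i <= (b / a) x_i ^ 2 + (a / b) y_i ^ 2] with [a] and [b] the norms
    of [x] and [y]. *)
Lemma ler_enormD x y : enorm (x + y) <= enorm x + enorm y.
Proof.
have [e0|x0] := eqVneq (enorm x) 0.
  suff -> : x = 0 by rewrite add0r enorm0 add0r.
  apply/rowP => i; rewrite mxE; apply/eqP; rewrite -normr_le0 -e0.
  exact: coord_le_enorm.
have [e0|y0] := eqVneq (enorm y) 0.
  suff -> : y = 0 by rewrite addr0 enorm0 addr0.
  apply/rowP => i; rewrite mxE; apply/eqP; rewrite -normr_le0 -e0.
  exact: coord_le_enorm.
have {}x0 : 0 < enorm x by rewrite lt_def x0 enorm_ge0.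
have {}y0 : 0 < enorm y by rewrite lt_def y0 enorm_ge0.
rewrite -(@ler_pXn2r _ 2) ?nnegrE ?addr_ge0 ?enorm_ge0//.
rewrite sqr_enorm; under eq_bigr do rewrite mxE sqrrD.
rewrite !big_split/= -!sqr_enorm sqrrD lerD2r lerD2l.
set a := enorm x in x0 *; set b := enorm y in y0 *.
have -> : (a * b) *+ 2 =
    \sum_i (b / a * x ord0 i ^+ 2 + a / b * y ord0 i ^+ 2).
  rewrite big_split/= -!mulr_sumr -!sqr_enorm -/a -/b.
  by field; rewrite !gt_eqF.
rewrite -big_split/=; apply: ler_sum => i _; rewrite -mulr2n -subr_ge0.
rewrite (_ : _ - _ = (b * x ord0 i - a * y ord0 i) ^+ 2 / (a * b)); last first.
  by field; rewrite !gt_eqF.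
by rewrite divr_ge0 ?sqr_ge0// mulr_ge0// ltW.
Qed.

Lemma enorm_sub_le x y z : enorm (x - z) <= enorm (x - y) + enorm (y - z).
Proof. by rewrite (le_trans _ (ler_enormD _ _))// addrA subrK. Qed.

Lemma enormC x y : enorm (x - y) = enorm (y - x).
Proof. by rewrite -enormN opprB. Qed.

Lemma cball_center c r : 0 <= r -> cball c r c.
Proof. by move=> r0; rewrite /cball/= subrr enorm0. Qed.

Lemma subset_cball c c' r r' : enorm (c - c') + r <= r' ->
  cball c r `<=` cball c' r'.
Proof.
move=> cr x /= xr; apply: le_trans cr.
by rewrite (le_trans (enorm_sub_le _ c _))// addrC lerD2l.
Qed.

Lemma continuous_enorm : continuous (@enorm R n).
Proof.
have sqc : continuous (fun x : 'rV[R]_N => \sum_i x ord0 i ^+ 2).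
  apply: continuous_big => [|i _ x]; first exact: add_continuous.
  apply: (@continuous_comp _ _ _ (fun x : 'rV[R]_N => x ord0 i)
    (fun t : R => t ^+ 2)); first exact: coord_continuous.
  exact: exprn_continuous.
move=> x; apply: (@continuous_comp _ _ _ (fun x : 'rV[R]_N =>
  \sum_i x ord0 i ^+ 2) Num.sqrt); [exact: sqc|exact: sqrt_continuous].
Qed.

Lemma closed_cball c r : closed (cball c r).
Proof.
rewrite (_ : cball c r = (fun x => enorm (x - c)) @^-1` [set t | t <= r])//.
apply: preimage_closed; last exact: closed_le.
move=> x _; apply: (@continuous_comp _ _ _ (fun x => x - c) enorm);
    last exact: continuous_enorm.
exact: (continuousB (@cvg_id _ _) (@cvg_cst _ _ _ _ _)).
Qed.

End euclidean_geometry.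

Section lebesgue_measure.
Context {R : realType} {n : nat}.
Implicit Types (a b c x y : 'rV[R]_n.+1) (r : R).
Local Notation N := n.+1.

Lemma leb_outer_unit_box_ge1 :
  (1%E <= leb_outer (box (0 : 'rV[R]_N) (const_mx 1%R)))%E.
Proof.
apply: le_ereal_inf_tmp => _ [c cov <-].
have -> : (\sum_(k <oo) (box_vol (c k).1 (c k).2)%:E = \sum_(k <oo)
    (1 * \prod_(i < N)
      Num.max 0 ((c k).2 ord0 (inord i) - (c k).1 ord0 (inord i)))%:E)%E.
  apply: eq_eseriesr => k _; rewrite mul1r /box_vol; congr _%:E.
  by apply: eq_bigr => i _; rewrite inord_val.
apply: (@box_cover_slicing R N (fun=> 1) (fun k i => (c k).1 ord0 (inord i))
   (fun k i => (c k).2 ord0 (inord i))) => // x x01.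
have [k _ xk] : (\bigcup_k box (c k).1 (c k).2) (\row_(i < N) x i).
  by apply: cov => i; rewrite !mxE; exact: x01.
apply: (@le_trans _ _ (1 * \prod_(i < N)
    \1_`](c k).1 ord0 (inord i), (c k).2 ord0 (inord i)] (x i))%:E); last first.
  by apply: nneseries_ge_term => j; rewrite lee_fin mul1r prodr_ge0.
rewrite mul1r lee_fin big1// => i _; rewrite indicE mem_set//= in_itv/= inord_val.
by have := xk i; rewrite mxE.
Qed.

(** A dilation by [r] followed by a translation by [c] maps a box to a box and
    multiplies its volume by [r ^ N]. *)
Lemma leb_outer_affine_le r c (A B : set 'rV[R]_N) : 0 < r ->
  (forall x, B x -> A (r^-1 *: (x - c))) ->
  (leb_outer B <= (r ^+ N)%:E * leb_outer A)%E.
Proof.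
move=> r0 BA; have rN0 : 0 < r ^+ N by rewrite exprn_gt0.
rewrite muleC -lee_pdivrMr//; apply: le_ereal_inf_tmp => _ [u cov <-].
rewrite lee_pdivrMr// muleC -nneseriesZl => [|k _]; last first.
  by rewrite lee_fin box_vol_ge0.
apply: ereal_inf_lbound.
exists (fun k => (r *: (u k).1 + c, r *: (u k).2 + c)) => /=.
  move=> x /BA /cov[k _ xk]; exists k => // i /=.
  have := xk i; rewrite !mxE ltr_pdivlMl// ler_pdivrMl//.
  by rewrite ltrBrDr lerBlDr.
apply: eq_eseriesr => k _; rewrite -EFinM; congr _%:E.
rewrite /box_vol -[X in r ^+ X]card_ord -prodr_const -big_split/=.
apply: eq_bigr => i _; rewrite !mxE opprD addrACA subrr addr0 -mulrBr.
by rewrite maxr_pMr ?mulr0// ltW.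
Qed.

(** The hyperplane [x_i = t] cuts every box of a cover into two boxes whose
    volumes add up to that of the box. *)
Lemma caratheodory_halfspace i (t : R) :
  caratheodory_measurable (@leb_outer R n) [set x | x ord0 i <= t].
Proof.
apply: le_caratheodory_measurable => X; apply: le_ereal_inf_tmp => _ [c cov <-].
pose upd x (v : R) : 'rV[R]_N := \row_j if j == i then v else x ord0 j.
pose u1 k := ((c k).1, upd (c k).2 (Num.min ((c k).2 ord0 i) t)).
pose u2 k := (upd (c k).1 (Num.max ((c k).1 ord0 i) t), (c k).2).
have -> : (\sum_(k <oo) (box_vol (c k).1 (c k).2)%:E =
    \sum_(k <oo) (box_vol (u1 k).1 (u1 k).2)%:E +
    \sum_(k <oo) (box_vol (u2 k).1 (u2 k).2)%:E)%E.
  rewrite -nneseriesD => [|k _|k _]; rewrite ?lee_fin ?box_vol_ge0//.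
  apply: eq_eseriesr => k _; rewrite -EFinD; congr _%:E.
  rewrite /box_vol (bigD1 i)//= [X in _ = X + _](bigD1 i)//=.
  rewrite [X in _ = _ + X](bigD1 i)//= !mxE eqxx.
  under [X in _ = _ * X + _]eq_bigr => j ji do rewrite mxE (negbTE ji).
  under [X in _ = _ + _ * X]eq_bigr => j ji do rewrite mxE (negbTE ji).
  rewrite -mulrDl; congr (_ * _).
  set p := (c k).1 ord0 i; set q := (c k).2 ord0 i.
  rewrite /Num.max /Num.min; do ! case: ifPn; rewrite -?leNgt; lra.
apply: leeD; apply: ereal_inf_lbound.
- exists u1 => // x [Xx xt]; have [k _ xk] := cov x Xx.
  exists k => // j /=; rewrite mxE; case: eqP => [->|_]; last exact: xk.
  by rewrite le_min xt andbT; exact: xk.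
- exists u2 => // x [Xx /negP]; rewrite -ltNge => xt; have [k _ xk] := cov x Xx.
  exists k => // j /=; rewrite mxE; case: eqP => [->|_]; last exact: xk.
  by rewrite gt_max xt andbT; exact: xk.
Qed.

Lemma measurable_coord i : measurable_fun [set: Rn R n]
  (fun x : Rn R n => x ord0 i).
Proof.
apply: (measurability _ (RGenOInfty.measurableE R)) => _ [_ [t ->] <-].
rewrite setTI; have -> : (fun x : Rn R n => x ord0 i) @^-1` `]t, +oo[ =
    ~` [set x | x ord0 i <= t].
  by apply/seteqP; split=> x /=; rewrite in_itv/= andbT ltNge => /negP.
exact/(@measurableC _ (Rn R n))/caratheodory_halfspace.
Qed.

Lemma measurable_enormB c : measurable_fun [set: Rn R n]
  (fun x : Rn R n => enorm (x - c)).
Proof.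
apply: (measurableT_comp (continuous_measurable_fun (@sqrt_continuous R))).
apply: measurable_sum => i; apply: measurable_funX.
rewrite [X in measurable_fun _ X](_ : _ = fun x : Rn R n => x ord0 i - c ord0 i).
  by apply: measurable_funB; [exact: measurable_coord|exact: measurable_cst].
by apply/funext => x; rewrite !mxE.
Qed.

Lemma measurable_enorm : measurable_fun [set: Rn R n] (@enorm R n).
Proof.
by have := measurable_enormB 0; under eq_fun do rewrite subr0.
Qed.

Lemma measurable_cball c r : measurable (cball c r : set (Rn R n)).
Proof.
rewrite (_ : cball c r = [set: Rn R n] `&` (fun x => enorm (x - c)) @^-1` `]-oo, r]).
  exact: measurable_enormB (measurable_itv _).
by apply/seteqP; split=> [x|x [_]]; rewrite /cball/= in_itv.
Qed.

Definition unit_ball_vol : R := fine (leb (cball (0 : 'rV[R]_N) 1)).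

Lemma leb_outer_box_le a b : (leb_outer (box a b) <= (box_vol a b)%:E)%E.
Proof.
apply: ereal_inf_lbound.
exists (fun k => if k == 0%N then (a, b) else (0, 0)).
  by move=> x ?; exists 0%N.
rewrite nneseries_recl//=; last by move=> k _; rewrite lee_fin box_vol_ge0.
rewrite eseries0 ?adde0// => -[//|k] _ _ /=.
by rewrite /box_vol big_ord_recl !mxE subrr maxxx mul0r.
Qed.

(** A dilation of the unit ball contains the unit box. *)
Lemma leb_unit_ball_gt0 : (0 < leb (cball (0 : 'rV[R]_N) 1))%E.
Proof.
have N0 : 0 < N%:R :> R by rewrite ltr0n.
have : (1%E <= (N%:R ^+ N)%:E * leb_outer (cball (0 : 'rV[R]_N) 1))%E.
  apply: (le_trans leb_outer_unit_box_ge1).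
  apply: (@leb_outer_affine_le _ 0) => // x x01; rewrite /cball/= !subr0.
  rewrite enormZ ger0_norm ?invr_ge0// ler_pdivrMl// mulr1.
  rewrite -[leRHS]mulr1; apply: enorm_le_coord => // i.
  by have := x01 i; rewrite !mxE => /andP[x0 x1]; rewrite ger0_norm// ltW.
rewrite /leb lt_neqAle leb_outer_ge0 andbT => h.
by apply: contraTneq h => <-; rewrite mule0 -ltNge lte_fin.
Qed.

Lemma leb_unit_ball_fin : leb (cball (0 : 'rV[R]_N) 1) \is a fin_num.
Proof.
rewrite ge0_fin_numE ?leb_outer_ge0//.
(* boxes are open on the left: one with lower corner [- 1] would miss points *)
apply: (@le_lt_trans _ _
    (leb_outer (box (const_mx (- 2)) (const_mx 1 : 'rV[R]_N)))).
  apply: le_leb_outer => x; rewrite /cball/= subr0 => x1 i; rewrite !mxE.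
  have := le_trans (coord_le_enorm x i) x1.
  by rewrite ler_norml => /andP[? ->]; rewrite andbT; lra.
by rewrite (le_lt_trans (leb_outer_box_le _ _))// ltry.
Qed.

Lemma unit_ball_vol_gt0 : 0 < unit_ball_vol.
Proof.
by rewrite fine_gt0// leb_unit_ball_gt0 ltey_eq leb_unit_ball_fin.
Qed.

Definition ball_vol r : R := unit_ball_vol * r ^+ N.

Lemma ball_vol_gt0 r : 0 < r -> 0 < ball_vol r.
Proof. by move=> r0; rewrite mulr_gt0 ?unit_ball_vol_gt0 ?exprn_gt0. Qed.

Lemma ball_volM (k r : R) : ball_vol (k * r) = k ^+ N * ball_vol r.
Proof. by rewrite /ball_vol exprMn mulrCA. Qed.

Lemma leb_cball c r : 0 < r -> leb (cball c r) = (ball_vol r)%:E.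
Proof.
move=> r0; have rN0 : 0 < r ^+ N by rewrite exprn_gt0.
rewrite /ball_vol EFinM fineK ?leb_unit_ball_fin// muleC.
apply/eqP; rewrite eq_le; apply/andP; split.
  apply: (@leb_outer_affine_le r c) => // x; rewrite /cball/= subr0 enormZ.
  by rewrite gtr0_norm ?invr_gt0// => xr; rewrite ler_pdivrMl ?mulr1.
rewrite -lee_pdivlMl// -exprVn.
apply: (@leb_outer_affine_le r^-1 (- (r^-1 *: c))); first by rewrite invr_gt0.
move=> x; rewrite /cball/= subr0 opprK invrK scalerDr scalerA divff ?gt_eqF//.
by rewrite scale1r addrK enormZ gtr0_norm// => x1; rewrite -[leRHS]mulr1 ler_pM2l.
Qed.

End lebesgue_measure.
Arguments ball_vol {R} n r.

(** * The Hardy-Littlewood maximal operator *)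

Section maximal_operator.
Context {R : realType} {n : nat}.
Implicit Types (c x y : 'rV[R]_n.+1) (r t : R).
Implicit Types (f g : 'rV[R]_n.+1 -> \bar R).
Local Notation N := n.+1.
Local Notation emeas f := (measurable_fun [set: Rn R n] (f : Rn R n -> \bar R)).

Lemma avg_cball_le f c r (z : \bar R) : 0 < r ->
  ((leb (cball c r))^-1 * \int[leb]_(y in cball c r) `|f y| <= z)%E =
  (\int[leb]_(y in cball c r) `|f y| <= (ball_vol n r)%:E * z)%E.
Proof.
move=> r0; have v0 : 0 < ball_vol n r by exact: ball_vol_gt0.
by rewrite leb_cball// inver gt_eqF// lee_pdivrMl.
Qed.

Lemma HL_max_lee f x (z : \bar R) :
  (HL_max f x <= z)%E <-> forall c r, 0 < r -> cball c r x ->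
    (\int[leb]_(y in cball c r) `|f y| <= (ball_vol n r)%:E * z)%E.
Proof.
split=> [fz c r r0 cx|h].
  rewrite -avg_cball_le//; apply: le_trans fz.
  by apply: ereal_sup_ubound; exists (c, r).
by apply: ge_ereal_sup => _ [[c r] /= [r0 cx] <-]; rewrite avg_cball_le//; exact: h.
Qed.

Lemma integral_cball_le_HL_max f x c r : 0 < r -> cball c r x ->
  (\int[leb]_(y in cball c r) `|f y| <= (ball_vol n r)%:E * HL_max f x)%E.
Proof. exact: (HL_max_lee f x _).1. Qed.

Lemma HL_max_ge0 f x : (0 <= HL_max f x)%E.
Proof.
have h : (0 <= (ball_vol n 1)%:E * HL_max f x)%E.
  apply: le_trans (@integral_cball_le_HL_max f x x 1 _ _) => //.
    by apply: integral_ge0.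
  exact: cball_center.
by rewrite -(@lee_pmul2l _ (ball_vol n 1)%:E) ?mule0 ?lte_fin ?ball_vol_gt0.
Qed.

Lemma lt_HL_max f x t : (t%:E < HL_max f x)%E <-> exists c r, [/\ 0 < r, cball c r x &
  ((t * ball_vol n r)%:E < \int[leb]_(y in cball c r) `|f y|)%E].
Proof.
split=> [tf|[c [r [r0 cx]]]].
  apply: contrapT => h; move: tf; apply/negP; rewrite -leNgt.
  apply/HL_max_lee => c r r0 cx; rewrite leNgt; apply/negP => tr; apply: h.
  by exists c, r; split => //; rewrite mulrC EFinM.
rewrite mulrC EFinM => /lt_le_trans /(_ (integral_cball_le_HL_max f r0 cx)).
by rewrite lte_pmul2l// lte_fin ball_vol_gt0.
Qed.

(** Enlarging a ball slightly keeps its average above [t], so that balls with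
    rational centers and radii suffice to describe superlevel sets. *)
Lemma rational_cball f c r t : emeas f -> 0 < r ->
  ((t * ball_vol n r)%:E < \int[leb]_(y in cball c r) `|f y|)%E ->
  exists q : 'rV[rat]_n.+1 * rat, [/\ 0 < ratr q.2 :> R,
    cball c r `<=` cball (map_mx ratr q.1) (ratr q.2) &
    ((t * ball_vol n (ratr q.2))%:E <
      \int[leb]_(y in cball (map_mx ratr q.1) (ratr q.2)) `|f y|)%E].
Proof.
move=> mf r0 tr.
have [e e0 he] : exists2 e : R, 0 < e & forall r', r < r' < r + e ->
    ((t * ball_vol n r')%:E < \int[leb]_(y in cball c r) `|f y|)%E.
  have : (0 <= \int[leb]_(y in cball c r) `|f y|)%E by exact: integral_ge0.
  case: (\int[leb]_(y in cball c r) `|f y|)%E tr => [i| |]//.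
    rewrite lte_fin => tr _.
    have ct : (fun r' => t * ball_vol n r') @ r --> t * ball_vol n r.
      by apply: cvgMr; apply: cvgMr; exact: exprn_continuous.
    have /nbhs_ballP[e e0 he] : \forall r' \near r, t * ball_vol n r' < i.
      exact: cvgr_lt ct _ tr.
    exists e => // r' /andP[rr' r'e]; rewrite lte_fin; apply: he.
    by rewrite /ball/= distrC ger0_norm ?subr_ge0 1?ltW// ltrBlDl.
  by move=> _ _; exists 1 => // r' _; rewrite ltry.
have [q2] : exists q : rat, ratr q \in `]r, r + e[ by apply: rat_in_itvoo;
    rewrite ltrDl.
rewrite in_itv/= => /andP[rq qe].
pose d := (ratr q2 - r) / N%:R.
have d0 : 0 < d by rewrite divr_gt0// subr_gt0.
have [q1 hq1] : {q1 : 'I_N -> rat & forall i, `|c ord0 i - ratr (q1 i)| <= d}.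
  apply: (@choice _ _ (fun i q => `|c ord0 i - ratr q| <= d)) => i.
  have [q] : exists q : rat, ratr q \in `](c ord0 i - d), (c ord0 i + d)[.
    by apply: rat_in_itvoo; rewrite ltrD2l gt0_cp.
  by rewrite in_itv/= => hq; exists q; rewrite ler_norml; lra.
have cB : cball c r `<=` cball (map_mx ratr (\row_i q1 i)) (ratr q2).
  apply: subset_cball; rewrite -lerBrDr.
  have -> : ratr q2 - r = N%:R * d by rewrite /d mulrC divfK.
  by apply: enorm_le_coord => [|i]; [exact: ltW|rewrite !mxE].
exists (\row_i q1 i, q2); split => //=; first exact: lt_trans rq.
apply: (lt_le_trans (he _ _)); first by rewrite rq.
apply: ge0_subset_integralT; [exact: measurable_cball|exact: measurable_cball| |by []|
    exact: cB].
exact: measurable_fun_abse.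
Qed.

(** The balls of [rational_cball], as a sequence: superlevel sets are countable
    unions of balls. *)
Definition big_average f t (i : nat) : option ('rV[R]_n.+1 * R) :=
  if unpickle i is Some q then
    let b := (map_mx ratr (q : 'rV[rat]_n.+1 * rat).1, ratr q.2) in
    if `[< 0 < b.2 /\ ((t * ball_vol n b.2)%:E <
      \int[leb]_(y in cball b.1 b.2) `|f y|)%E >] then Some b else None
  else None.

Definition ocball (b : option ('rV[R]_n.+1 * R)) : set (Rn R n) :=
  if b is Some b then cball b.1 b.2 else set0.

Lemma measurable_ocball b : measurable (ocball b).
Proof. by case: b => [b|]; [exact: measurable_cball|exact: measurable0]. Qed.

Lemma big_averageP f t i b : big_average f t i = Some b -> 0 < b.2 /\
  ((t * ball_vol n b.2)%:E < \int[leb]_(y in cball b.1 b.2) `|f y|)%E.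
Proof.
by rewrite /big_average; case: unpickle => // q; case: asboolP => // h [<-].
Qed.

Lemma superlevel_HL_max f t : emeas f ->
  [set x | (t%:E < HL_max f x)%E] = \bigcup_i ocball (big_average f t i).
Proof.
move=> mf; apply/seteqP; split=> [x /lt_HL_max[c [r [r0 cx]]]|x [i _]].
  move=> /(rational_cball mf r0)[q [q0 cq tq]].
  exists (pickle q) => //; rewrite /big_average pickleK/=.
  by case: asboolP => [_|[]//]; exact: cq.
case E : big_average => [b|//] bx; apply/lt_HL_max; exists b.1, b.2.
by have [] := big_averageP E.
Qed.

Lemma measurable_HL_max f : emeas f -> emeas (HL_max f).
Proof.
move=> mf; apply: (measurability _ (ErealGenOInfty.measurableE R)) => _ [_ [t ->] <-].
rewrite setTI (_ : _ @^-1` _ = \bigcup_i ocball (big_average f t i)); last first.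
  by rewrite -superlevel_HL_max//; apply/seteqP; split=> x /=; rewrite in_itv/= andbT.
by apply: bigcupT_measurable => i; exact: measurable_ocball.
Qed.

(** Vitali covering: the balls meeting a largest ball are inside its threefold
    dilation, and the others live in the complement of that ball, where the
    induction hypothesis applies. *)
Lemma vitali_covering g t (L : seq ('rV[R]_n.+1 * R)) (A : set (Rn R n)) :
  measurable A -> emeas g -> (forall x, 0 <= g x)%E -> 0 <= t ->
  (forall b, b \in L -> [/\ 0 < b.2, cball b.1 b.2 `<=` A &
     ((t * ball_vol n b.2)%:E <= \int[leb]_(y in cball b.1 b.2) g y)%E]) ->
  (t%:E * leb (\big[setU/set0]_(b <- L) (cball b.1 b.2 : set (Rn R n)))
    <= (3 ^+ N)%:E * \int[leb]_(y in A) g y)%E.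
Proof.
move=> mA mg g0 t0; have [m] := ubnP (size L).
elim: m L A mA => // m ih L A mA sL hL.
have [->|[b1 b1L hmax]] : L = [::] \/
    exists2 b1, b1 \in L & forall b, b \in L -> b.2 <= b1.2.
  elim: (L) => [|b L' [->|[b1 b1L hb1]]]; [by left| |]; right.
    by exists b => [|b']; rewrite !inE// => /eqP ->.
  have [b1b|bb1] := leP b1.2 b.2.
    exists b => [|b']; rewrite !inE ?eqxx// => /orP[/eqP ->//|/hb1].
    by move/le_trans; apply.
  exists b1 => [|b']; rewrite !inE ?b1L ?orbT// => /orP[/eqP ->|/hb1//].
  exact: ltW.
  by rewrite big_nil measure0 mule0 mule_ge0// integral_ge0.
have [b10 b1A tb1] := hL _ b1L.
pose L' := [seq b <- L | `[< cball b.1 b.2 `&` cball b1.1 b1.2 = set0 >]].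
have sL' : (size L' < m)%N.
  rewrite -ltnS; apply: leq_trans sL; rewrite ltnS.
  rewrite size_filter -(count_predC (fun b : 'rV[R]_n.+1 * R =>
    `[< cball b.1 b.2 `&` cball b1.1 b1.2 = set0 >])).
  rewrite -[ltnLHS]addn0 ltn_add2l -has_count; apply/hasP; exists b1 => //=.
  apply/negP => /asboolP h; have : (cball b1.1 b1.2 `&` cball b1.1 b1.2) b1.1.
    by split; apply: cball_center; exact: ltW.
  by rewrite h.
have mU (s : seq ('rV[R]_n.+1 * R)) :
    measurable (\big[setU/set0]_(b <- s) (cball b.1 b.2 : set (Rn R n))).
  by apply: bigsetU_measurable => b _; exact: measurable_cball.
have mB1 : measurable (cball b1.1 b1.2 : set (Rn R n)) by exact: measurable_cball.
have LU : \big[setU/set0]_(b <- L) (cball b.1 b.2 : set (Rn R n)) `<=`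
    cball b1.1 (3 * b1.2) `|` \big[setU/set0]_(b <- L') (cball b.1 b.2 : set (Rn R n)).
  rewrite -!bigcup_seq => x [b /= bL bx].
  have [bb1|bb1] := pselect (cball b.1 b.2 `&` cball b1.1 b1.2 = set0).
    by right; exists b => //=; rewrite mem_filter bL andbT; exact/asboolP.
  left; move/eqP/set0P : bb1 => [y [/= yb yb1]]; rewrite /cball/= in bx yb yb1 *.
  have := enorm_sub_le x y b1.1; have := enorm_sub_le x b.1 y.
  by have := hmax _ bL; rewrite (enormC b.1 y); lra.
have ihL' := ih L' (A `\` cball b1.1 b1.2) (measurableD mA mB1) sL' _.
apply: (@le_trans _ _ (t%:E * (leb (cball b1.1 (3 * b1.2)) +
    leb (\big[setU/set0]_(b <- L') (cball b.1 b.2 : set (Rn R n)))))%E).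
  apply: lee_wpmul2l; first by rewrite lee_fin.
  apply: (@le_trans _ _ (leb (cball b1.1 (3 * b1.2) `|`
     \big[setU/set0]_(b <- L') (cball b.1 b.2 : set (Rn R n))))).
    apply: le_measure; rewrite ?inE//.
    by apply: measurableU => //; exact: measurable_cball.
  by apply: measureU2 => //; exact: measurable_cball.
rewrite muleDr//; last by rewrite ge0_adde_def// inE.
rewrite -(setDUK b1A) ge0_integral_setU//; last 3 first.
- exact: measurableD.
- exact: measurable_funTS.
- by rewrite disj_set2E setDIK.
rewrite muleDr//; last by rewrite ge0_adde_def// inE integral_ge0.
apply: leeD.
  rewrite leb_cball ?mulr_gt0// ball_volM -EFinM mulrCA EFinM.
  by apply: lee_wpmul2l => //; rewrite lee_fin exprn_ge0.
apply: ihL' => b; rewrite mem_filter => /andP[/asboolP bb1 bL].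
have [b0 bA tb] := hL _ bL; split => // x bx; split; first exact: bA.
by move=> b1x; have : (cball b.1 b.2 `&` cball b1.1 b1.2) x by []; rewrite bb1.
Qed.

(** Replacing [f] by its part above [t / 2] lowers averages by at most
    [t / 2]; this localized form of the weak type inequality is what can be
    summed over levels [t]. *)
Lemma HL_max_weak_type f t : emeas f -> 0 < t ->
  (t%:E * leb [set x | (t%:E < HL_max f x)%E] <=
   (2 * 3 ^+ N)%:E * \int[leb]_(x in [set x | ((t / 2)%:E < `|f x|)%E]) `|f x|)%E.
Proof.
move=> mf t0; pose D : set (Rn R n) := [set x | ((t / 2)%:E < `|f x|)%E].
have mabs : emeas (fun x => `|f x|)%E by exact: measurable_fun_abse.
have mD : measurable D.
  exact: measurable_lt_ereal.
pose g : 'rV[R]_N -> \bar R := ((fun x => `|f x|)%E \_ D).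
have g0 x : (0 <= g x)%E by rewrite /g patchE; case: ifP.
have mg : emeas g by exact: measurable_fun_restrict.
have fg x : (`|f x| <= g x + (t / 2)%:E)%E.
  rewrite /g patchE; case: ifPn => [_|]; first
      by rewrite leeDl// lee_fin divr_ge0// ltW.
  by rewrite notin_setE /D/= add0e => /negP; rewrite -leNgt.
rewrite -/D [X in (_ <= _ * X)%E](_ : _ = \int[leb]_x g x)%E; last first.
  by rewrite [LHS]integral_mkcond.
rewrite superlevel_HL_max//.
set E := fun i => ocball (big_average f t i).
pose F m := \big[setU/set0]_(i < m) E i.
have mF m : measurable (F m) by apply: bigsetU_measurable => i _;
    exact: measurable_ocball.
have leF m : (t%:E * leb (F m) <= (2 * 3 ^+ N)%:E * \int[leb]_x g x)%E.
  pose L := pmap (big_average f t) (index_iota 0 m).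
  have -> : F m = \big[setU/set0]_(b <- L) (cball b.1 b.2 : set (Rn R n)).
    rewrite big_pmap big_mkord; apply: eq_bigr => i _.
    by rewrite /E /ocball; case: big_average.
  have -> : t%:E = (2%:E * (t / 2)%:E)%E by rewrite -EFinM mulrC divfK.
  rewrite EFinM -!muleA; apply: lee_wpmul2l; first by rewrite lee_fin.
  apply: vitali_covering => //; first by rewrite divr_ge0// ltW.
  move=> b; rewrite mem_pmap => /mapP[i _ /esym/big_averageP[b0 tb]].
  have mB : measurable (cball b.1 b.2 : set (Rn R n)) by exact: measurable_cball.
  split => //; have v0 : 0 < ball_vol n b.2 by exact: ball_vol_gt0.
  have : (\int[leb]_(y in cball b.1 b.2) `|f y| <=
      \int[leb]_(y in cball b.1 b.2) g y + (t / 2 * ball_vol n b.2)%:E)%E.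
    rewrite EFinM -(leb_cball b.1 b0) -(integral_cst leb mB (t / 2)%:E).
    have mt : emeas (cst (t / 2)%:E) by exact: measurable_cst.
    rewrite -ge0_integralDT//; last by move=> x; rewrite lee_fin divr_ge0// ltW.
    apply: ge0_le_integralT; [by []|by []| |by []|by []].
    exact: emeasurable_funD.
  move=> /(lt_le_trans tb)/ltW.
  have -> : t * ball_vol n b.2 = t / 2 * ball_vol n b.2 + t / 2 * ball_vol n b.2
      by field.
  by rewrite EFinD leeD2rE.
have ndF : nondecreasing_seq F.
  by move=> i j ij; apply/subsetPset; exact: subset_bigsetU.
have UF : \bigcup_m F m = \bigcup_i E i.
  apply/seteqP; split=> [x [m _ Fx]|x [m _ Fx]].
    by have [k _ Ek] := bigsetU_bigcup Fx; exists k.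
  by exists m.+1 => //; rewrite /F big_ord_recr; right.
have mUF : measurable (\bigcup_m F m) by exact: bigcupT_measurable.
have cF := nondecreasing_cvg_mu (mu := @leb R n) mF mUF ndF.
rewrite -UF -(cvg_lim _ cF)// -limeMl//; last by apply/cvg_ex; eexists; exact: cF.
apply: lime_le; last by apply: nearW => m; exact: leF.
by apply: is_cvgeZl => //; apply/cvg_ex; eexists; exact: cF.
Qed.

(** The weak type constant [2 * 3 ^ N], a factor [2 ^ s] for the distance between
    consecutive levels, and the sum of the powers [(t 2 ^ j) ^ (s - 1)] of the
    levels below [2 |f|], at most [dyadic_ratio s * (2 |f|) ^ (s - 1)]. *)
Definition HL_strong_cst (s : R) : R :=
  2 * 3 ^+ N * 2 `^ s * dyadic_ratio s * 2 `^ (s - 1).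

(** The strong type inequality for [1 < s], localized to a set [E]: on [E] the
    values of [HL_max f] below the level [t] cost at most [t ^ s |E|], and those
    above are summed over the levels [t 2 ^ j] with the weak type inequality. *)
Lemma HL_max_strong_type f s t (E : set (Rn R n)) :
  emeas f -> 1 < s -> 0 < t -> measurable E ->
  (\int[leb]_(x in E) HL_max f x `^ s <=
    (t `^ s)%:E * leb E + (HL_strong_cst s)%:E * \int[leb]_x `|f x| `^ s)%E.
Proof.
move=> mf s1 t0 mE; have s0 : 0 < s by exact: lt_trans s1.
have mabs : emeas (fun x => `|f x|)%E by exact: measurable_fun_abse.
have mM : emeas (HL_max f) by exact: measurable_HL_max.
pose l j := t * 2 ^+ j.
have l0 j : 0 < l j by rewrite mulr_gt0// exprn_gt0.
pose c j := (l j.+1) `^ s.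
have c0 j : 0 <= c j by exact: powR_ge0.
pose S j : set (Rn R n) := [set x | ((l j)%:E < HL_max f x)%E].
have mS j : measurable (S j) by exact: measurable_lt_ereal.
have mh j : emeas (fun x => (c j)%:E * (\1_(S j) x)%:E)%E.
  by apply: emeasurable_funZl; apply/measurable_EFinP; exact: measurable_indic.
have h0 j x : (0 <= (c j)%:E * (\1_(S j) x)%:E)%E by rewrite mule_ge0// lee_fin.
have mhs : emeas (fun x => \sum_(j <oo) (c j)%:E * (\1_(S j) x)%:E)%E.
  exact: ge0_emeasurable_sumT.
have t_s0 : (0 <= (t `^ s)%:E)%E by rewrite lee_fin powR_ge0.
have mt : emeas (cst (t `^ s)%:E) by exact: measurable_cst.
apply: (@le_trans _ _ (\int[leb]_(x in E)
    ((t `^ s)%:E + \sum_(j <oo) (c j)%:E * (\1_(S j) x)%:E)))%E.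
  apply: ge0_le_integralT; [exact: mE| | | | ].
  - exact: measurable_fun_poweR.
  - exact: emeasurable_funD.
  - by move=> x _; exact: poweR_ge0.
  - move=> x _; rewrite (eq_eseriesr (g := fun j => (c j)%:E *
      ((l j)%:E < HL_max f x)%E%:R%:E)%E).
      by apply: poweR_le_dyadic_levels => //; exact: HL_max_ge0.
    move=> j _; rewrite indicE; congr (_ * (nat_of_bool _)%:R%:E)%E.
    by apply/idP/idP; rewrite inE.
rewrite ge0_integralDT; [|exact: mE|exact: mt|exact: mhs|by []|]; last first.
  by move=> x; apply: nneseries_ge0 => j _ _; exact: h0.
rewrite integral_cst//; apply: leeD => //.
rewrite integral_nneseriesT; [|exact: mE|exact: mh|exact: h0].
pose D j : set (Rn R n) := [set x | ((l j / 2)%:E < `|f x|)%E].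
have mD j : measurable (D j) by exact: measurable_lt_ereal.
pose g j := ((fun x => `|f x|)%E \_ (D j)).
have g0 j x : (0 <= g j x)%E by rewrite /g patchE; case: ifP.
have mg j : emeas (g j) by exact: measurable_fun_restrict.
pose A := 2 `^ s * (2 * 3 ^+ N) : R.
have A0 : 0 <= A by rewrite mulr_ge0 ?powR_ge0 ?mulr_ge0 ?exprn_ge0.
pose u j := l j `^ (s - 1).
have mu_g j : emeas (fun x => (u j)%:E * g j x)%E by exact: emeasurable_funZl.
have ug0 j x : (0 <= (u j)%:E * g j x)%E by rewrite mule_ge0// lee_fin powR_ge0.
have step j : (\int[leb]_(x in E) ((c j)%:E * (\1_(S j) x)%:E) <=
    A%:E * \int[leb]_x ((u j)%:E * g j x))%E.
  have mSj : emeas (fun x => (\1_(S j) x)%:E).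
    by apply/measurable_EFinP; exact: measurable_indic.
  rewrite ge0_integralZlT; [|exact: mE|exact: mSj|by move=> x; rewrite lee_fin|
      exact: c0].
  rewrite integral_indic; [|exact: mE|exact: mS].
  rewrite ge0_integralZlT; [|exact: measurableT|exact: mg|exact: g0|exact: powR_ge0].
  apply: (@le_trans _ _ ((c j)%:E * leb (S j))%E).
    apply: lee_wpmul2l; first by rewrite lee_fin.
    by apply: le_measure; rewrite ?inE//; exact: measurableI.
  have -> : (c j)%:E = ((2 `^ s * u j)%:E * (l j)%:E)%E.
    rewrite -EFinM /c /u; congr _%:E.
    have -> : l j.+1 = 2 * l j by rewrite /l exprS mulrCA.
    by rewrite powRM ?ltW// -mulrA [_ * l j]mulrC mulr_powRB1// ltW.
  have wt := HL_max_weak_type mf (l0 j).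
  rewrite -muleA; apply: (le_trans (lee_wpmul2l _ wt)).
    by rewrite lee_fin mulr_ge0 ?powR_ge0.
  by rewrite [in leRHS]/g -integral_mkcond !muleA -!EFinM mulrAC.
apply: (@le_trans _ _ (\sum_(j <oo) A%:E * \int[leb]_x ((u j)%:E * g j x)))%E.
  apply: lee_nneseries => [j _ _|j _]; last exact: step.
  by apply: integral_ge0 => x _; exact: h0.
rewrite nneseriesZl; last by move=> j _; apply: integral_ge0 => x _; exact: ug0.
have -> : HL_strong_cst s = A * (dyadic_ratio s * 2 `^ (s - 1)).
  by rewrite /HL_strong_cst /A; ring.
rewrite [X in (_ <= X * _)%E]EFinM -muleA.
apply: lee_wpmul2l; first by rewrite lee_fin.
rewrite -integral_nneseriesT; [|exact: measurableT|exact: mu_g|exact: ug0].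
have mfs : emeas (fun x => `|f x| `^ s)%E by exact: measurable_fun_poweR.
have D0 : 0 < dyadic_ratio s * 2 `^ (s - 1).
  by rewrite mulr_gt0 ?dyadic_ratio_gt0 ?powR_gt0.
rewrite -ge0_integralZlT; [|exact: measurableT|exact: mfs|by move=> x;
    exact: poweR_ge0|exact: ltW].
apply: ge0_le_integralT; [exact: measurableT|exact: ge0_emeasurable_sumT|
  exact: emeasurable_funZl| |].
  by move=> x _; apply: nneseries_ge0 => j _ _; exact: ug0.
move=> x _; apply: lime_le; first by apply: is_cvg_nneseries => j _ _; exact: ug0.
apply: nearW => k; rewrite big_mkord /g.
under eq_bigr do rewrite patchE.
have : (0 <= `|f x|)%E by exact: abse_ge0.
have inD j : (x \in D j) = ((l j / 2)%:E < `|f x|)%E by apply/idP/idP; rewrite inE.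
under eq_bigr do rewrite inD.
case: (`|f x|)%E => [y| |]// y0; last first.
  by rewrite poweRyr ?gt_eqF// gt0_muley ?lte_fin// leey.
rewrite lee_fin in y0.
rewrite (eq_bigr (fun j : 'I_k => (y * (u j * (l j < 2 * y)%R%:R))%:E)); last first.
  move=> j _; rewrite lte_fin ltr_pdivrMr// [y * 2]mulrC [y * (_ * _)]mulrC.
  rewrite (_ : point = 0%E)//.
  by case: ifPn => _; rewrite ?mulr1 ?mulr0 ?mul0r ?mule0// EFinM.
rewrite sumEFin lee_fin -mulr_sumr.
apply: (le_trans (ler_wpM2l y0 (dyadic_sum_le k s1 t0 _))); first by rewrite mulr_ge0.
rewrite powRM// -(mulr_powRB1 y0 s0) le_eqVlt; apply/orP; left.
by apply/eqP; ring.
Qed.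

End maximal_operator.

(** * Nonnegative blocks *)

(** Properties that hold almost everywhere form a filter for a bundled measure;
    this transfers the fact to the bare function [leb], over which block
    decompositions quantify. *)
#[local] Instance ae_leb_filter (R : realType) n :
  Filter (nbhs (almost_everywhere (@leb R n))).
Proof.
exact: (@ae_filter_ringOfSetsType _ _ _ (@leb R n : {measure set (Rn R n) -> \bar R})).
Qed.

Lemma integral_cball_cst (R : realType) n (c : 'rV[R]_n.+1) r (k : R) : 0 < r ->
  (\int[leb]_(x in cball c r) k%:E = (k * ball_vol n r)%:E)%E.
Proof.
move=> r0; rewrite EFinM -(leb_cball c r0).
exact: (integral_cst _ (measurable_cball c r)).
Qed.

Section nonneg_blocks.
Context {R : realType} {n : nat}.
Implicit Types (c x y : 'rV[R]_n.+1) (r t s theta : R).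
Implicit Types (f g : 'rV[R]_n.+1 -> \bar R).
Local Notation N := n.+1.
Local Notation emeas f := (measurable_fun [set: Rn R n] (f : Rn R n -> \bar R)).

(** Normalized by [int b ^ s <= |B| ^ (1 - theta s)], which says that the
    [L^s]-average of [b] over its ball [B] is at most the height
    [|B| ^ - theta].  For [theta = alpha / (p N) + 1 / p] this is the size
    condition of a [(p, s, alpha)]-block, and the conditions on [alpha] become
    [1 / s <= theta < 1]. *)
Definition nonneg_block s theta c r (b : 'rV[R]_n.+1 -> \bar R) : Prop :=
  [/\ 0 < r, emeas b, forall x, (0 <= b x)%E, forall x, ~ cball c r x -> b x = 0%E &
    (\int[leb]_x b x `^ s <= (ball_vol n r `^ (1 - theta * s))%:E)%E].

Definition block_height (p alpha : R) : R := alpha / (p * N%:R) + p^-1.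

Lemma block_nonneg p s alpha (a : 'rV[R]_n.+1 -> R) : 0 < s ->
  block p s%:E alpha a -> exists c r,
    nonneg_block s (block_height p alpha) c r (fun x => `|a x|%:E).
Proof.
move=> s0 [ma [c [r [r0 sa na]]]]; exists c, r.
split; [exact: r0|exact: measurable_fun_normE|by move=> x; rewrite lee_fin| |].
- move=> x cx; apply/eqP; rewrite eqe normr_eq0; apply/eqP; apply: contrapT => ax.
  by apply/cx/sa/subset_closure; exact/eqP.
have s_neq0 : s != 0 by rewrite gt_eqF.
have := le_poweR (ltW s0) (Lnorm_ge0 _ _ _) na.
rewrite poweR_Lnorm// -poweRrM leb_cball// inver (negbTE s_neq0)/=.
rewrite (_ : _ * s = 1 - block_height p alpha * s)//.
rewrite mulrDl mulVf// /block_height.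
by move: (alpha / _) (p^-1) => A B; ring.
Qed.

(** The ball being closed, it contains the closure of every set inside it. *)
Lemma nonneg_block_block p s alpha c r (a : 'rV[R]_n.+1 -> R)
    (b : 'rV[R]_n.+1 -> \bar R) : 0 < s ->
  measurable_fun [set: Rn R n] a -> (forall x, (`|a x|%:E <= b x)%E) ->
  nonneg_block s (block_height p alpha) c r b -> block p s%:E alpha a.
Proof.
move=> s0 ma ab [r0 mb b0 bc bs]; have s_neq0 : s != 0 by rewrite gt_eqF.
split=> //; exists c, r; split => //.
  rewrite (closure_id (cball c r)).1; last exact: closed_cball.
  apply: closureS => x /= ax; apply: contrapT => /bc bx.
  by have := ab x; rewrite bx lee_fin normr_le0 (negbTE ax).
rewrite unlock leb_cball// inver (negbTE s_neq0)/=.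
have mas : emeas (fun x => `|a x|%:E `^ s)%E.
  by apply: measurable_fun_poweR; exact: measurable_fun_normE.
apply: (@le_trans _ _ ((ball_vol n r `^ (1 - block_height p alpha * s))%:E `^ s^-1)%E).
  apply: le_poweR; first by rewrite invr_ge0 ltW.
    by apply: integral_ge0 => x _; rewrite lee_fin powR_ge0.
  apply: le_trans bs; apply: ge0_le_integralT; [exact: measurableT|exact: mas| | |].
  - exact: measurable_fun_poweR.
  - by move=> x _; rewrite lee_fin powR_ge0.
  - by move=> x _; apply: (@le_poweR _ s `|a x|%:E); [exact: ltW|rewrite lee_fin|].
rewrite poweR_EFin -powRrM lee_fin le_eqVlt; apply/orP; left; apply/eqP.
congr (_ `^ _); rewrite mulrBl mul1r mulfK// /block_height.
by rewrite addrC opprD.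
Qed.

(** A substitute for Holder's inequality: with [h] the height of the block,
    [t <= h ^ (1 - s) t ^ s + h] for every value [t], according as [t] is above
    or below [h]. *)
Lemma nonneg_block_integral_le s theta c r b : 1 < s ->
  nonneg_block s theta c r b ->
  (\int[leb]_x b x <= (2 * ball_vol n r `^ (1 - theta))%:E)%E.
Proof.
move=> s1 [r0 mb b0 bc bs]; have s0 : 0 < s by exact: lt_trans s1.
have v0 : 0 < ball_vol n r by exact: ball_vol_gt0.
have vD (e1 e2 : R) : ball_vol n r `^ (e1 + e2) = ball_vol n r `^ e1 *
    ball_vol n r `^ e2.
  exact: powRD_gt0.
pose h := ball_vol n r `^ (- theta).
have h0 : 0 < h by exact: powR_gt0.
pose k := ball_vol n r `^ (theta * s - theta).
have k0 : 0 < k by exact: powR_gt0.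
have mB : measurable (cball c r : set (Rn R n)) by exact: measurable_cball.
have mbs : emeas (fun x => b x `^ s)%E by exact: measurable_fun_poweR.
have mI : emeas (fun x => (\1_(cball c r : set (Rn R n)) x)%:E).
  by apply/measurable_EFinP; exact: measurable_indic.
have I0 x : (0 <= (\1_(cball c r : set (Rn R n)) x)%:E :> \bar R)%E by rewrite lee_fin.
apply: (@le_trans _ _ (\int[leb]_x (k%:E * b x `^ s +
    h%:E * (\1_(cball c r : set (Rn R n)) x)%:E)))%E.
  apply: ge0_le_integralT; [exact: measurableT|exact: mb| | by []|].
    by apply: emeasurable_funD; exact: emeasurable_funZl.
  move=> x _; have [cx|/bc ->] := pselect (cball c r x); last first.
    by rewrite adde_ge0// mule_ge0 ?lee_fin ?poweR_ge0// ltW.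
  rewrite indicE mem_set// mule1.
  case: (b x) (b0 x) => [t| |]// t0; last first.
    by rewrite poweRyr ?gt_eqF// gt0_muley ?lte_fin.
  rewrite lee_fin in t0; rewrite poweR_EFin -EFinM -EFinD lee_fin.
  have [th|ht] := leP t h; first
      by rewrite (le_trans th)// lerDr mulr_ge0 ?powR_ge0// ltW.
  rewrite (@le_trans _ _ (k * t `^ s))//; last by rewrite lerDl ltW.
  have -> : k = h `^ (1 - s) by rewrite /h -powRrM /k; congr (_ `^ _); ring.
  have h1 : 1 <= t / h by rewrite ler_pdivlMr// mul1r ltW.
  have -> : h `^ (1 - s) * t `^ s = h * (t / h) `^ s.
    rewrite powRM ?invr_ge0 ?(ltW h0)// powR_inv ?(ltW h0)//.
    by rewrite powRD_gt0// powRr1 ?(ltW h0)//; ring.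
  rewrite -{1}(divfK (lt0r_neq0 h0) t) mulrC ler_pM2l//.
  by rewrite le1r_powR// ltW.
rewrite ge0_integralDT; [|exact: measurableT|exact: emeasurable_funZl|
  exact: emeasurable_funZl| |]; last 2 first.
- by move=> x; rewrite mule_ge0 ?poweR_ge0// lee_fin ltW.
- by move=> x; rewrite mule_ge0// lee_fin ltW.
rewrite ge0_integralZlT; [|exact: measurableT|exact: mbs|by move=> x;
    exact: poweR_ge0|exact: ltW].
rewrite ge0_integralZlT; [|exact: measurableT|exact: mI|exact: I0|exact: ltW].
rewrite integral_indic; [|exact: measurableT|exact: mB].
rewrite (_ : _ (_ `&` _) = (ball_vol n r)%:E); last by rewrite setIT; exact: leb_cball.
apply: (@le_trans _ _ (k%:E * (ball_vol n r `^ (1 - theta * s))%:E +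
    h%:E * (ball_vol n r)%:E)%E).
  by apply: leeD => //; apply: lee_wpmul2l => //; rewrite lee_fin ltW.
rewrite -!EFinM -EFinD lee_fin /k /h -powRD_gt0//.
rewrite -{3}(powRr1 (ltW v0)) -powRD_gt0//.
rewrite (_ : theta * s - theta + _ = 1 - theta); last by ring.
by rewrite (_ : - theta + 1 = 1 - theta); [lra|ring].
Qed.

(** This is where the two bounds on [theta] are used: small balls are controlled
    by the [L^1] bound, whose exponent [1 - theta] is nonnegative, and large
    balls by the [L^s] bound, whose exponent [1 - theta s] is nonpositive. *)
Lemma nonneg_block_locally_bounded s theta (rho : R) : 1 < s -> s^-1 <= theta ->
  theta <= 1 -> 0 < rho -> exists2 C : R, 0 <= C &
  forall c r b, nonneg_block s theta c r b ->
    (\int[leb]_(x in cball (0 : 'rV[R]_N) rho) b x <= C%:E)%E.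
Proof.
move=> s1 sth th1 rho0; have s0 : 0 < s by exact: lt_trans s1.
have v1 : 0 < ball_vol n 1 :> R by exact: ball_vol_gt0.
exists (Num.max (2 * ball_vol n 1 `^ (1 - theta))
    (ball_vol n 1 `^ (1 - theta * s) + ball_vol n rho)).
  by rewrite le_max mulr_ge0 ?powR_ge0.
move=> c r b bb; have [r0 mb b0 bc bs] := bb.
have vr : 0 < ball_vol n r by exact: ball_vol_gt0.
have mK : measurable (cball (0 : 'rV[R]_N) rho : set (Rn R n))
    by exact: measurable_cball.
have [r1|r1] := leP r 1.
  apply: (@le_trans _ _ (\int[leb]_x b x)%E).
    by apply: ge0_subset_integralT; [exact: mK|exact: measurableT|exact: mb|
        exact: b0|by []].
  apply: (le_trans (nonneg_block_integral_le s1 bb)).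
  rewrite lee_fin le_max; apply/orP; left; rewrite ler_pM2l//.
  apply: ge0_ler_powR; rewrite ?nnegrE ?subr_ge0 ?(ltW v1) ?(ltW vr)//.
  rewrite /ball_vol ler_pM2l ?unit_ball_vol_gt0//.
  by rewrite lerXn2r// nnegrE// ltW.
have mbs : emeas (fun x => b x `^ s)%E by exact: measurable_fun_poweR.
have m1 : emeas (cst 1%E) by exact: measurable_cst.
apply: (@le_trans _ _ (\int[leb]_(x in cball (0 : 'rV[R]_N) rho) (b x `^ s + 1)))%E.
  apply: ge0_le_integralT; [exact: mK|exact: mb|exact: emeasurable_funD|by []|].
  move=> x _; case: (b x) (b0 x) => [t| |]// t0; last by rewrite poweRyr ?gt_eqF.
  rewrite poweR_EFin -EFinD lee_fin; have [t1|t1] := leP t 1.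
    by rewrite (le_trans t1)// lerDr powR_ge0.
  by rewrite (le_trans (le1r_powR (ltW t1) (ltW s1)))// lerDl.
rewrite ge0_integralDT; [|exact: mK|exact: mbs|exact: m1|by move=> x;
    exact: poweR_ge0|by []].
rewrite integral_cball_cst// mul1r.
apply: (@le_trans _ _ ((ball_vol n 1 `^ (1 - theta * s))%:E +
    (ball_vol n rho)%:E)%E); last first.
  by rewrite -EFinD lee_fin le_max lexx orbT.
apply: leeD => //.
apply: (@le_trans _ _ (\int[leb]_x b x `^ s)%E).
  by apply: ge0_subset_integralT; [exact: mK|exact: measurableT|
      exact: mbs|by move=> x; exact: poweR_ge0|by []].
apply: (le_trans bs); rewrite lee_fin.
have e0 : 0 <= theta * s - 1 by rewrite subr_ge0 -ler_pdivrMr// mul1r.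
rewrite -[1 - theta * s]opprB !powRN lef_pV2 ?posrE ?powR_gt0//.
apply: ge0_ler_powR => //; rewrite ?nnegrE ?(ltW v1) ?(ltW vr)//.
rewrite /ball_vol ler_pM2l ?unit_ball_vol_gt0//.
by rewrite lerXn2r ?nnegrE// ltW.
Qed.

Lemma nonneg_block_series_finite s theta (mu : nat -> R)
    (c : nat -> 'rV[R]_N) (r : nat -> R) (b : nat -> 'rV[R]_N -> \bar R) : 1 < s ->
  s^-1 <= theta -> theta <= 1 -> (forall k, 0 <= mu k) ->
  (\sum_(k <oo) (mu k)%:E < +oo)%E ->
  (forall k, nonneg_block s theta (c k) (r k) (b k)) ->
  {ae (@leb R n), forall x, (\sum_(k <oo) (mu k)%:E * b k x < +oo)%E}.
Proof.
move=> s1 sth th1 mu0 smu bb.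
have mb k : emeas (b k) by case: (bb k).
have b0 k x : (0 <= b k x)%E by case: (bb k).
have mmb k : emeas (fun x => (mu k)%:E * b k x)%E by exact: emeasurable_funZl.
have mb0 k x : (0 <= (mu k)%:E * b k x)%E by rewrite mule_ge0 ?lee_fin.
suff H m : {ae (@leb R n), forall x, cball (0 : 'rV[R]_N) m.+1%:R x ->
    (\sum_(k <oo) (mu k)%:E * b k x < +oo)%E}.
  have := ae_foralln H; apply: filterS => x Hx.
  apply: (Hx (Num.bound (enorm x))); rewrite /cball/= subr0.
  rewrite (le_trans (ltW (archi_boundP (enorm_ge0 x))))// ler_nat//.
have m0 : 0 < m.+1%:R :> R by rewrite ltr0n.
have [C C0 hC] := nonneg_block_locally_bounded s1 sth th1 m0.
have mK : measurable (cball (0 : 'rV[R]_N) m.+1%:R : set (Rn R n))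
    by exact: measurable_cball.
have mS : emeas (fun x => \sum_(k <oo) (mu k)%:E * b k x)%E.
  exact: ge0_emeasurable_sumT.
have S0 x : (0 <= \sum_(k <oo) (mu k)%:E * b k x)%E by exact: nneseries_ge0.
have : leb.-integrable (cball (0 : 'rV[R]_N) m.+1%:R)
    (fun x => \sum_(k <oo) (mu k)%:E * b k x)%E.
  apply/integrableP; split; first exact: measurable_funTS.
  under eq_integral do rewrite gee0_abs//.
  rewrite integral_nneseriesT; [|exact: mK|exact: mmb|exact: mb0].
  apply: (@le_lt_trans _ _ (\sum_(k <oo) C%:E * (mu k)%:E)%E).
    apply: lee_nneseries => [k _ _|k _]; first by apply: integral_ge0.
    rewrite ge0_integralZlT; [|exact: mK|exact: mb|exact: b0|exact: mu0].
    by rewrite muleC; apply: lee_wpmul2r; [rewrite lee_fin|exact: hC].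
  rewrite nneseriesZl; last by move=> k _; rewrite lee_fin.
  by apply: lte_mul_pinfty.
move=> /integrable_ae; move=> /(_ mK); apply: filterS => x h /h.
by rewrite ge0_fin_numE.
Qed.

(** Multiply every term of the dominating series by the ratio of [f] to the sum
    of the series: the ratio is at most 1, so that blocks remain blocks, and the
    sum is finite almost everywhere. *)
Lemma block_decomposition_dominated (p : R) s (alpha : R) f (mu : nat -> R)
    (c : nat -> 'rV[R]_N) (r : nat -> R) (b : nat -> 'rV[R]_N -> \bar R) :
  0 < p -> 1 < s -> s^-1 <= block_height p alpha -> block_height p alpha <= 1 ->
  (forall k, 0 <= mu k) -> (\sum_(k <oo) (mu k `^ pbar p)%:E < +oo)%E ->
  (forall k, nonneg_block s (block_height p alpha) (c k) (r k) (b k)) ->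
  emeas f -> (forall x, 0 <= f x)%E ->
  (forall x, f x <= \sum_(k <oo) (mu k)%:E * b k x)%E ->
  exists a, block_decomposition p s%:E alpha f mu a.
Proof.
move=> p0 s1 sth th1 mu0 smup bb mf f0 fG.
have smu : (\sum_(k <oo) (mu k)%:E < +oo)%E.
  apply: (@summable_of_powR _ (pbar p)) => //; rewrite ?lt_min ?p0 ?ltr01//.
  by rewrite ge_min lexx orbT.
have s0 : 0 < s by exact: lt_trans s1.
have mb k : emeas (b k) by case: (bb k).
have b0 k x : (0 <= b k x)%E by case: (bb k).
have mb0 k x : (0 <= (mu k)%:E * b k x)%E by rewrite mule_ge0 ?lee_fin.
pose G x := (\sum_(k <oo) (mu k)%:E * b k x)%E.
have G0 x : (0 <= G x)%E by exact: nneseries_ge0.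
have mmb k : emeas (fun x => (mu k)%:E * b k x)%E by exact: emeasurable_funZl.
have mG : emeas G by exact: ge0_emeasurable_sumT.
pose q x := Num.min 1 (fine (f x) * fine (G x) `^ (-1)).
have mq : measurable_fun [set: Rn R n] (q : Rn R n -> R).
  apply: measurable_minr; first exact: measurable_cst.
  apply: measurable_funM; first exact: measurable_fun_fine.
  by apply: measurable_fun_powR; exact: measurable_fun_fine.
have q0 x : 0 <= q x.
  by rewrite le_min ler01 mulr_ge0 ?powR_ge0// fine_ge0.
have q1 x : q x <= 1 by rewrite ge_min lexx.
exists (fun k x => fine (b k x) * q x); split => [k||].
- apply: (nonneg_block_block s0 _ _ (bb k)).
    by apply: measurable_funM; [exact: measurable_fun_fine|exact: mq].
  move=> x; rewrite ger0_norm ?mulr_ge0 ?fine_ge0//.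
  apply: (@le_trans _ _ (fine (b k x))%:E).
    by rewrite lee_fin ler_piMr ?fine_ge0.
  by case: (b k x) (b0 k x) => [t| |]// _; exact: leey.
- by under eq_eseriesr do rewrite ger0_norm//.
have := nonneg_block_series_finite s1 sth th1 mu0 smu bb.
apply: filterS => x Gfin; have {}Gfin : G x \is a fin_num by rewrite ge0_fin_numE.
have ffin : f x \is a fin_num.
  by rewrite ge0_fin_numE// (le_lt_trans (fG x))// ltey_eq Gfin.
split=> //.
have fq : fine (f x) = fine (G x) * q x.
  have fG' : fine (f x) <= fine (G x) by apply: fine_le => //; exact: fG.
  have [g0|g0] := eqVneq (fine (G x)) 0.
    by rewrite g0 mul0r; apply/eqP; rewrite eq_le -{1}g0 fG' fine_ge0.
  have {}g0 : 0 < fine (G x) by rewrite lt_def g0 fine_ge0.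
  rewrite /q powR_inv1 ?(ltW g0)// min_r; last by rewrite ler_pdivrMr// mul1r.
  by rewrite mulrCA divff ?mulr1// gt_eqF.
have bfin k : mu k != 0 -> b k x \is a fin_num.
  move=> mk; rewrite ge0_fin_numE//.
  have mk0 : 0 < mu k by rewrite lt_def mk mu0.
  have : ((mu k)%:E * b k x < +oo)%E.
    by rewrite (le_lt_trans (nneseries_ge_term k (mb0^~ x)))// ltey_eq Gfin.
  by rewrite !ltey; apply: contraNneq => ->; rewrite gt0_muley ?lte_fin.
have bE k : ((mu k * fine (b k x))%:E = (mu k)%:E * b k x)%E.
  have [->|/bfin bk] := eqVneq (mu k) 0; first by rewrite mul0r mul0e.
  by rewrite EFinM fineK.
have cvG : [series mu k * fine (b k x)]_k @ \oo --> fine (G x).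
  have cv : (fun m => \sum_(0 <= k < m) (mu k)%:E * b k x)%E @ \oo --> (fine (G x))%:E.
    by rewrite fineK//; apply: is_cvg_nneseries => k _ _; exact: mb0.
  rewrite (_ : [series _]_k = fine \o
    (fun m => \sum_(0 <= k < m) (mu k)%:E * b k x)%E); first exact: fine_cvg cv.
  by apply/funext => m; rewrite /series/= -(eq_bigr _ (fun k _ => bE k)) sumEFin.
rewrite fq (_ : [series _]_k = fun m => [series mu k * fine (b k x)]_k m * q x).
  by apply: cvgM => //; exact: cvg_cst.
apply/funext => m; rewrite /series/= mulr_suml.
by apply: eq_bigr => k _; rewrite mulrA.
Qed.

(** The measurable sets are those of Caratheodory, so that null sets are
    measurable. *)
Lemma ae_measurable_leb f g : emeas f -> {ae (@leb R n), forall x, f x = g x} ->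
    emeas g.
Proof.
move=> mf fg; apply: (@ae_measurable_fun _ (Rn R n) R leb _ setT f g _ mf).
  exact: measure_is_complete_caratheodory.
by move: fg; apply: filterS => x.
Qed.

(** The sum of a block series is defined almost everywhere only; it agrees there
    with the upper limit of the partial sums. *)
Lemma measurable_block_series (p : R) (s : \bar R) (alpha : R) f lam a :
  block_decomposition p s alpha f lam a -> emeas f.
Proof.
move=> [ba _ fa].
pose S m x := (\sum_(0 <= k < m) lam k * a k x)%:E.
apply: (@ae_measurable_leb (fun x => limn_esup (S ^~ x))).
  apply: measurable_fun_limn_esup => m; apply/measurable_EFinP.
  apply: measurable_sum => k; apply: measurable_funM; first exact: measurable_cst.
  by case: (ba k).
apply: filterS fa => x [fx cvx]; rewrite -(fineK fx).
have cvS : S ^~ x @ \oo --> (fine (f x))%:E.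
  by apply: cvg_EFin; [exact: nearW|exact: cvx].
rewrite is_cvg_limn_esupE; first exact: (cvg_lim _ cvS).
by apply/cvg_ex; eexists; exact: cvS.
Qed.

Lemma block_series_abs_le (p : R) (s : \bar R) (alpha : R) f lam a :
  block_decomposition p s alpha f lam a -> {ae (@leb R n), forall x,
    (`|f x| <= \sum_(k <oo) `|lam k|%:E * `|a k x|%:E)%E}.
Proof.
move=> [_ _]; apply: filterS => x [fx cvx]; rewrite -(fineK fx).
have cv : (fun m => `|[series lam k * a k x]_k m|%:E) @ \oo --> `|(fine (f x))%:E|%E.
  by apply: cvg_EFin; [exact: nearW|exact: cvg_norm cvx].
rewrite -(cvg_lim _ cv)//; apply: lime_le; first by apply/cvg_ex; eexists; exact: cv.
apply: nearW => m; apply: le_trans (nneseries_lim_ge m _); last first.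
  by move=> k _ _; rewrite mule_ge0 ?lee_fin.
rewrite (eq_bigr (fun k => (`|lam k * a k x|)%:E)); last by move=> k _;
    rewrite normrM EFinM.
by rewrite sumEFin lee_fin ler_norm_sum.
Qed.

Lemma HL_max_le_series f (mu : nat -> R) (g : nat -> 'rV[R]_N -> \bar R) x :
  emeas f -> (forall k, 0 <= mu k) -> (forall k, emeas (g k)) ->
  (forall k x, 0 <= g k x)%E ->
  {ae (@leb R n), forall x, (`|f x| <= \sum_(k <oo) (mu k)%:E * g k x)%E} ->
  (HL_max f x <= \sum_(k <oo) (mu k)%:E * HL_max (g k) x)%E.
Proof.
move=> mf mu0 mg g0 fg; apply/HL_max_lee => c r r0 cx.
have mB : measurable (cball c r : set (Rn R n)) by exact: measurable_cball.
have mmg k : emeas (fun x => (mu k)%:E * g k x)%E by exact: emeasurable_funZl.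
have mg0 k y : (0 <= (mu k)%:E * g k y)%E by rewrite mule_ge0 ?lee_fin.
have mS : emeas (fun x => \sum_(k <oo) (mu k)%:E * g k x)%E.
  exact: ge0_emeasurable_sumT.
apply: (@le_trans _ _ (\int[leb]_(y in cball c r) \sum_(k <oo) (mu k)%:E * g k y))%E.
  apply: ae_ge0_le_integral; [exact: mB|by []| |by move=> y _; exact: nneseries_ge0| |].
  - by apply: measurable_funTS; exact: measurable_fun_abse.
  - exact: measurable_funTS.
  - by apply: filterS fg => y h _.
rewrite integral_nneseriesT; [|exact: mB|exact: mmg|exact: mg0].
rewrite -nneseriesZl; last by move=> k _; rewrite mule_ge0 ?HL_max_ge0 ?lee_fin.
apply: lee_nneseries => [k _ _|k _]; first by apply: integral_ge0.
rewrite ge0_integralZlT; [|exact: mB|exact: mg|exact: g0|exact: mu0].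
rewrite muleCA; apply: lee_wpmul2l; first by rewrite lee_fin.
apply: le_trans (integral_cball_le_HL_max (g k) r0 cx).
by under [leRHS]eq_integral do rewrite gee0_abs//.
Qed.

End nonneg_blocks.
Arguments block_height {R} n p alpha.

(** * The maximal function of a sum of blocks *)

Section maximal_function_of_blocks.
Context {R : realType} {n : nat}.
Implicit Types (c x y : 'rV[R]_n.+1) (r t s theta : R).
Implicit Types (f g : 'rV[R]_n.+1 -> \bar R).
Local Notation N := n.+1.
Local Notation emeas f := (measurable_fun [set: Rn R n] (f : Rn R n -> \bar R)).

(** A ball through a point far from the block has to be large in order to meet
    the block, and the mass of the block is bounded. *)
Lemma HL_max_block_far s theta c r b j x : 1 < s -> nonneg_block s theta c r b ->
  (0 < j)%N -> ~ cball c (2 ^+ j * r) x ->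
  (HL_max b x <= (2 * 4 ^+ N * ((2 ^+ j) ^+ N)^-1 * ball_vol n r `^ (- theta))%:E)%E.
Proof.
move=> s1 bb j0 xj; have [r0 mb b0 bc bs] := bb.
have v0 : 0 < ball_vol n r by exact: ball_vol_gt0.
apply/HL_max_lee => y rho rho0 yx.
have vrho : 0 < ball_vol n rho by exact: ball_vol_gt0.
have mB : measurable (cball y rho : set (Rn R n)) by exact: measurable_cball.
have [meet|meet] := pselect (exists z, cball y rho z /\ cball c r z); last first.
  rewrite integral0_eq.
    rewrite -EFinM lee_fin (mulr_ge0 (ltW vrho))//.
    by rewrite !mulr_ge0 ?powR_ge0 ?invr_ge0 ?exprn_ge0.
  move=> z yz; rewrite bc ?abse0// => cz; apply: meet; by exists z.
have large : 2 ^+ j * r <= 4 * rho.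
  have [z [yz cz]] := meet; move: xj yx yz cz; rewrite /cball/= => /negP.
  rewrite -ltNge => xj yx yz cz.
  have := enorm_sub_le x y c; have := enorm_sub_le y z c; rewrite (enormC y z).
  have : 2 <= 2 ^+ j :> R by case: (j) j0 => // i _;
      rewrite exprS ler_peMr// exprn_ege1// ler1n.
  move=> j2; have : 2 * r <= 2 ^+ j * r by rewrite ler_pM2r.
  lra.
apply: (@le_trans _ _ (2 * ball_vol n r `^ (1 - theta))%:E).
  apply: le_trans (nonneg_block_integral_le s1 bb).
  under eq_integral do rewrite gee0_abs//.
  by apply: ge0_subset_integralT; [exact: mB|exact: measurableT|exact: mb|
      exact: b0|by []].
rewrite -EFinM lee_fin powRD_gt0// powRr1 ?(ltW v0)//.
have jN0 : 0 < (2 ^+ j) ^+ N :> R by rewrite !exprn_gt0.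
have vol : (2 ^+ j) ^+ N * ball_vol n r <= 4 ^+ N * ball_vol n rho.
  rewrite -!ball_volM /ball_vol ler_pM2l ?unit_ball_vol_gt0// lerXn2r// nnegrE.
    by rewrite mulr_ge0 ?exprn_ge0// ltW.
  by rewrite mulr_ge0// ltW.
rewrite mulrA !(mulrCA (ball_vol n rho)) mulrA; apply: ler_wpM2r; first exact: powR_ge0.
by rewrite -!mulrA ler_pM2l// mulrCA ler_pdivlMl// mulrC.
Qed.

(** Index 0 is the whole doubled ball, so that the annuli cover the space. *)
Definition annulus c r (j : nat) : set (Rn R n) :=
  if j is 0%N then cball c (2 * r)
  else cball c (2 ^+ j.+1 * r) `\` cball c (2 ^+ j * r).

Lemma measurable_annulus c r j : measurable (annulus c r j).
Proof.
by case: j => [|j]; [|apply: measurableD]; exact: measurable_cball.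
Qed.

Lemma annulus_sub c r j : annulus c r j `<=` cball c (2 ^+ j.+1 * r).
Proof. by case: j => [|j]; [rewrite expr1|exact: subDsetl]. Qed.

Lemma annulus_cover c r x : 0 < r -> exists j, annulus c r j x.
Proof.
move=> r0; have ex : exists j, enorm (x - c) <= 2 ^+ j.+1 * r.
  exists (Num.bound (enorm (x - c) / r)); rewrite -ler_pdivrMr//.
  have e0 : 0 <= enorm (x - c) / r by rewrite divr_ge0 ?enorm_ge0// ltW.
  rewrite (le_trans (ltW (archi_boundP e0)))// -natrX ler_nat.
  by rewrite ltnW// (leq_trans (ltn_expl _ (isT : (1 < 2)%N)))// leq_exp2l.
have [j xj jmin] := ex_minnP ex; exists j.
case: j xj jmin => [|j] xj jmin; first by rewrite expr1 in xj.
by split => // /jmin; rewrite ltnn.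
Qed.

(** Spreading a block over a ball of twice the radius divides its average by
    [2 ^ N], while the height allowed to a block decreases by [2 ^ (N theta)]
    only; this is the ratio of the two. *)
Definition decay theta : R := 2 `^ (- (N%:R * (1 - theta))).

Lemma decay_gt0 theta : 0 < decay theta.
Proof. exact: powR_gt0. Qed.

Lemma decay_lt1 theta : theta < 1 -> decay theta < 1.
Proof.
move=> th1; have -> : 1 = 2 `^ 0 :> R by rewrite powRr0.
rewrite /decay /powR gt_eqF// ltr_expR ltr_pM2r ?ln_gt0 ?ltr1n//.
by rewrite oppr_lt0 mulr_gt0 ?ltr0n// subr_gt0.
Qed.

(** The first summand bounds the maximal function of a block on the doubled ball,
    the second one on the annuli. *)
Definition pieces_cst s : R :=
  (2 ^+ N + @HL_strong_cst R n s) `^ s^-1 * 2 ^+ N + 2 * 4 ^+ N * 2 ^+ N.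

Lemma pieces_cst_gt0 s : 0 < pieces_cst s.
Proof.
by apply: ltr_wpDl; rewrite ?mulr_ge0 ?powR_ge0 ?exprn_ge0// !mulr_gt0 ?exprn_gt0.
Qed.

(** On the doubled ball this is the strong type inequality at the height of the
    block; on the other annuli the pointwise bound of [HL_max_block_far] is
    integrated. *)
Lemma annulus_integral_le s theta c r b j : 1 < s -> theta <= 1 ->
  nonneg_block s theta c r b ->
  (\int[leb]_(x in annulus c r j) HL_max b x `^ s <=
   ((pieces_cst s * decay theta ^+ j) `^ s *
    ball_vol n (2 ^+ j.+1 * r) `^ (1 - theta * s))%:E)%E.
Proof.
move=> s1 th1 bb; have [r0 mb b0 bc bs] := bb.
have s0 : 0 < s by exact: lt_trans s1.
have v0 : 0 < ball_vol n r by exact: ball_vol_gt0.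
have K0 := ltW (pieces_cst_gt0 s).
have mbM : emeas (HL_max b) by exact: measurable_HL_max.
have mMs : emeas (fun x => HL_max b x `^ s)%E by exact: measurable_fun_poweR.
have Ms0 x : (0 <= HL_max b x `^ s)%E by exact: poweR_ge0.
have mD := measurable_annulus c r j.
have twoN (e : R) k : ((2 ^+ k) ^+ N : R) `^ e = 2 `^ (k%:R * N%:R * e).
  by rewrite -exprM -powR_mulrn// -powRrM natrM.
case: j mD => [|j] mD.
  rewrite expr0 mulr1 expr1.
  pose h := ball_vol n r `^ (- theta).
  have h0 : 0 < h by exact: powR_gt0.
  have hs : h `^ s * ball_vol n r = ball_vol n r `^ (1 - theta * s).
    rewrite /h -powRrM -{2}(powRr1 (ltW v0)) -powRD_gt0//.
    by congr (_ `^ _); ring.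
  apply: (le_trans (HL_max_strong_type mb s1 h0 mD)).
  rewrite /annulus leb_cball ?mulr_gt0// ball_volM -EFinM mulrCA hs.
  have C0 : 0 <= @HL_strong_cst R n s.
    apply: mulr_ge0; last exact: powR_ge0.
    apply: mulr_ge0; last exact: ltW (dyadic_ratio_gt0 s1).
    by rewrite !mulr_ge0 ?powR_ge0 ?exprn_ge0.
  set w := ball_vol n r `^ (1 - theta * s).
  apply: (@le_trans _ _ ((2 ^+ N * w)%:E + (@HL_strong_cst R n s)%:E * w%:E)%E).
    apply: leeD => //; apply: lee_wpmul2l; first by rewrite lee_fin.
    by under eq_integral do rewrite gee0_abs//.
  rewrite -EFinM -EFinD lee_fin -mulrDl.
  rewrite powRM ?exprn_ge0// ?(ltW v0)// -/w mulrA.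
  apply: ler_wpM2r; first exact: powR_ge0.
  have k1 : (2 ^+ N + @HL_strong_cst R n s) `^ s^-1 * 2 ^+ N <= pieces_cst s.
    by rewrite lerDl !mulr_ge0 ?exprn_ge0.
  apply: (@le_trans _ _ (((2 ^+ N + @HL_strong_cst R n s) `^ s^-1 * 2 ^+ N) `^ s *
      (2 ^+ N) `^ (1 - theta * s))); last first.
    apply: ler_wpM2r; first exact: powR_ge0.
    apply: ge0_ler_powR; rewrite ?nnegrE ?(ltW s0)//.
    by rewrite mulr_ge0 ?powR_ge0 ?exprn_ge0.
  have A0 : 0 <= 2 ^+ N + @HL_strong_cst R n s by rewrite addr_ge0 ?exprn_ge0.
  rewrite powRM ?powR_ge0 ?exprn_ge0// -powRrM mulVf ?gt_eqF// powRr1//.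
  rewrite -mulrA -powRD_gt0 ?exprn_gt0// ler_peMr//.
  have := @ler_powR R (2 ^+ N) _ 0 (s + (1 - theta * s)); rewrite powRr0; apply.
    by rewrite exprn_ege1// ler1n.
  by have := ler_wpM2r (ltW s0) th1; lra.
pose V := ball_vol n (2 ^+ j.+2 * r).
have V0 : 0 < V by rewrite ball_vol_gt0// mulr_gt0 ?exprn_gt0.
pose H := 2 * 4 ^+ N * ((2 ^+ j.+1) ^+ N)^-1 * ball_vol n r `^ (- theta).
have H0 : 0 <= H by rewrite !mulr_ge0 ?powR_ge0 ?invr_ge0 ?exprn_ge0.
have mH : emeas (cst (H `^ s)%:E) by exact: measurable_cst.
apply: (@le_trans _ _ (\int[leb]_(x in cball c (2 ^+ j.+2 * r)) (H `^ s)%:E)%E).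
  apply: (@le_trans _ _ (\int[leb]_(x in annulus c r j.+1) (H `^ s)%:E)%E).
    apply: ge0_le_integralT; [exact: mD|exact: mMs|exact: mH|by []|].
    move=> x [_ xj]; rewrite -poweR_EFin; apply: le_poweR; [exact: ltW|
        exact: HL_max_ge0|].
    exact: HL_max_block_far s1 bb _ xj.
  apply: ge0_subset_integralT; [exact: mD|exact: measurable_cball|exact: mH| |
      exact: annulus_sub].
  by move=> x; rewrite lee_fin powR_ge0.
have R0 : 0 < 2 ^+ j.+2 * r by rewrite mulr_gt0 ?exprn_gt0.
rewrite (integral_cball_cst c (H `^ s) R0) -/V lee_fin.
have -> : V `^ (1 - theta * s) = (V `^ (- theta)) `^ s * V.
  rewrite -powRrM -{3}(powRr1 (ltW V0)) -powRD_gt0//.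
  by congr (_ `^ _); ring.
have k0 : 0 <= pieces_cst s * decay theta ^+ j.+1.
  by rewrite mulr_ge0 ?exprn_ge0 ?(ltW (decay_gt0 _)).
have W0 : 0 <= V `^ (- theta) by exact: powR_ge0.
rewrite mulrA -(powRM _ k0 W0); apply: ler_wpM2r; first exact: ltW.
apply: ge0_ler_powR; [exact: ltW|by rewrite nnegrE|by rewrite nnegrE mulr_ge0|].
rewrite /H /V ball_volM powRM ?exprn_ge0 ?(ltW v0)// mulrA.
apply: ler_wpM2r; first exact: powR_ge0.
rewrite twoN -(powR_inv1 (exprn_ge0 _ (exprn_ge0 _ _)))// twoN.
have dE : decay theta ^+ j.+1 = 2 `^ (- (N%:R * (1 - theta)) * j.+1%:R).
  by rewrite -powR_mulrn ?powR_ge0// /decay -powRrM.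
rewrite dE -[leRHS]mulrA -powRD_gt0//.
rewrite [X in _ <= _ * _ `^ X](_ : _ = - (N%:R * theta) + j.+1%:R * N%:R * (-1));
    last first.
  by rewrite -[j.+2%:R]natr1; ring.
rewrite powRD_gt0// mulrA; apply: ler_wpM2r; first exact: powR_ge0.
apply: (@le_trans _ _ (2 * 4 ^+ N * 2 ^+ N * 2 `^ (- (N%:R * theta)))).
  rewrite -[leRHS]mulrA; apply: ler_peMr; first by rewrite mulr_ge0 ?exprn_ge0.
  rewrite -powR_mulrn// -powRD_gt0//.
  have := @ler_powR R 2 _ 0 (N%:R - N%:R * theta); rewrite powRr0; apply.
    by rewrite ler1n.
  by have := ler_wpM2l (ler0n R N) th1; lra.
apply: ler_wpM2r; first exact: powR_ge0.
by rewrite /pieces_cst lerDr mulr_ge0 ?powR_ge0 ?exprn_ge0.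
Qed.

(** The restriction of the maximal function to an annulus, divided by the factor
    found in [annulus_integral_le], is a block on a dyadic dilation of the ball. *)
Lemma HL_max_block_pieces s theta c r b : 1 < s -> theta <= 1 ->
  nonneg_block s theta c r b ->
  exists B : nat -> 'rV[R]_N -> \bar R,
    (forall j, nonneg_block s theta c (2 ^+ j.+1 * r) (B j)) /\
    forall x, (HL_max b x <=
      \sum_(j <oo) (pieces_cst s * decay theta ^+ j)%:E * B j x)%E.
Proof.
move=> s1 th1 bb; have [r0 mb b0 bc bs] := bb.
have s0 : 0 < s by exact: lt_trans s1.
pose k j := pieces_cst s * decay theta ^+ j.
have k0 j : 0 < k j by rewrite mulr_gt0 ?pieces_cst_gt0 ?exprn_gt0 ?decay_gt0.
have mM : emeas (HL_max b) by exact: measurable_HL_max.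
have mMs : emeas (fun x => HL_max b x `^ s)%E by exact: measurable_fun_poweR.
pose B j x := ((k j)^-1%:E * (HL_max b \_ (annulus c r j)) x)%E.
have B0 j x : (0 <= B j x)%E.
  rewrite mule_ge0//; first by rewrite lee_fin invr_ge0 ltW.
  by rewrite patchE; case: ifP => // _; exact: HL_max_ge0.
exists B; split=> [j|x].
  have mD := measurable_annulus c r j.
  have mMD : emeas (HL_max b \_ (annulus c r j)) by exact: measurable_fun_restrict.
  split; [by rewrite mulr_gt0 ?exprn_gt0|exact: emeasurable_funZl|exact: B0| |].
    move=> x xj; rewrite /B patchE memNset ?mule0//.
    by move=> /annulus_sub.
  have -> : (\int[leb]_x B j x `^ s =
      (((k j) `^ s)^-1)%:E * \int[leb]_(x in annulus c r j) HL_max b x `^ s)%E.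
    rewrite -ge0_integralZlT; [|exact: mD|exact: mMs|by move=> x; exact: poweR_ge0|
      by rewrite invr_ge0 powR_ge0].
    rewrite [RHS]integral_mkcond; apply: eq_integral => x _.
    rewrite /B !patchE; case: ifP => _; last by rewrite mule0 poweR0r ?gt_eqF.
    rewrite poweRM ?lee_fin ?invr_ge0 ?HL_max_ge0 ?(ltW (k0 j))//.
    by rewrite poweR_EFin powR_inv ?(ltW (k0 j))// powRN.
  rewrite lee_pdivrMl ?powR_gt0// -EFinM.
  exact: annulus_integral_le.
have [j xj] := annulus_cover c x r0.
apply: le_trans (nneseries_ge_term j _); last first.
  by move=> i; rewrite mule_ge0// lee_fin ltW// k0.
rewrite /B patchE mem_set// muleA -EFinM -/(k j) divff ?gt_eqF//.
by rewrite mul1e.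
Qed.

(** The coefficients [mu] are the products of those of [f] with the geometric
    sequence of [HL_max_block_pieces]; this makes [A] a geometric sum. *)
Lemma HL_max_block_series (p s alpha : R) : 0 < p -> 1 < s ->
  block_height n p alpha < 1 -> exists2 A : R, 0 < A &
  forall f lam a, block_decomposition p s%:E alpha f lam a ->
  exists (mu : nat -> R) (c : nat -> 'rV[R]_N) (r : nat -> R)
    (B : nat -> 'rV[R]_N -> \bar R),
  [/\ forall k, 0 <= mu k,
     forall k, nonneg_block s (block_height n p alpha) (c k) (r k) (B k),
     (\sum_(k <oo) (mu k `^ pbar p)%:E =
       A%:E * \sum_(k <oo) (`|lam k| `^ pbar p)%:E)%E &
     forall x, (HL_max f x <= \sum_(k <oo) (mu k)%:E * B k x)%E].
Proof.
move=> p0 s1; set theta := block_height n p alpha => th1.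
have s0 : 0 < s by exact: lt_trans s1.
have pb0 : 0 < pbar p by rewrite lt_min p0 ltr01.
pose z := decay theta `^ pbar p.
have z0 : 0 < z by rewrite powR_gt0// decay_gt0.
have z1 : z < 1.
  have := @gt0_ltr_powR _ _ pb0 _ _ _ _ (decay_lt1 th1).
  by rewrite powR1; apply; rewrite nnegrE ?ltW// decay_gt0.
have K0 := pieces_cst_gt0 s.
exists (pieces_cst s `^ pbar p * (1 - z)^-1).
  by rewrite mulr_gt0 ?powR_gt0// invr_gt0 subr_gt0.
move=> f lam a fa; have [ba _ _] := fa.
have /choice[cr hcr] k : exists cr : 'rV[R]_N * R,
    nonneg_block s theta cr.1 cr.2 (fun x => `|a k x|%:E).
  by have [c [r h]] := block_nonneg s0 (ba k); exists (c, r).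
have /choice[B hB] k := HL_max_block_pieces s1 (ltW th1) (hcr k).
have [phi hphi] := @nneseries_pairing R.
pose kd j := pieces_cst s * decay theta ^+ j.
have kd0 j : 0 <= kd j by rewrite mulr_ge0 ?exprn_ge0// ltW// decay_gt0.
exists (fun i => `|lam (phi i).1| * kd (phi i).2), (fun i => (cr (phi i).1).1),
  (fun i => 2 ^+ (phi i).2.+1 * (cr (phi i).1).2), (fun i => B (phi i).1 (phi i).2).
have B0 k j x : (0 <= B k j x)%E by have [/(_ j)[]] := hB k.
split.
- by move=> i; rewrite mulr_ge0.
- by move=> i; exact: (hB _).1.
- rewrite (hphi (fun k j => ((`|lam k| * kd j) `^ pbar p)%:E)); last first.
    by move=> k j; rewrite lee_fin powR_ge0.
  rewrite -nneseriesZl; last by move=> k _; rewrite lee_fin powR_ge0.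
  apply: eq_eseriesr => k _; rewrite muleC.
  transitivity (\sum_(j <oo) (`|lam k| `^ pbar p * pieces_cst s `^ pbar p)%:E *
      (z ^+ j)%:E)%E.
    apply: eq_eseriesr => j _; rewrite -EFinM; congr _%:E.
    rewrite powRM// /kd powRM ?exprn_ge0 ?(ltW K0) ?(ltW (decay_gt0 _))// mulrA.
    by rewrite powR_exprn// ltW// decay_gt0.
  rewrite nneseriesZl; last by move=> j _; rewrite lee_fin exprn_ge0 ?ltW.
  by rewrite nneseries_geometric ?(ltW z0)// -!EFinM mulrA.
move=> x; rewrite (hphi (fun k j => (`|lam k| * kd j)%:E * B k j x)%E); last first.
  by move=> k j; rewrite mule_ge0// lee_fin mulr_ge0.
apply: (@le_trans _ _ (\sum_(k <oo) `|lam k|%:E * HL_max (fun x => `|a k x|%:E) x)%E).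
  apply: HL_max_le_series; [exact: measurable_block_series fa|by []| |
    by move=> k y; rewrite lee_fin|exact: block_series_abs_le fa].
  by move=> k; case: (hcr k).
apply: lee_nneseries => [k _ _|k _]; first by rewrite mule_ge0 ?lee_fin ?HL_max_ge0.
under eq_eseriesr do rewrite EFinM -muleA.
rewrite nneseriesZl; last by move=> j _; rewrite mule_ge0 ?lee_fin.
by apply: lee_wpmul2l; rewrite ?lee_fin//; exact: (hB k).2.
Qed.

End maximal_function_of_blocks.

(** * Embedding into weighted Lebesgue spaces *)

Section weighted_embedding.
Context {R : realType} {n : nat}.
Implicit Types (c x y : 'rV[R]_n.+1) (r t s theta : R).
Implicit Types (f g : 'rV[R]_n.+1 -> \bar R).
Local Notation N := n.+1.
Local Notation emeas f := (measurable_fun [set: Rn R n] (f : Rn R n -> \bar R)).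

(** Where [enorm x < r], the term of the dyadic shell around 0 containing [x]
    dominates the weight.  At the origin the left-hand side is at most 1, powers
    of 0 being 0 or 1. *)
Lemma radial_weight_le (beta : R) x r : beta <= 0 -> 0 < r ->
  (((enorm x / r) `^ beta)%:E <= 1%:E + \sum_(j <oo)
     (((2^-1 ^+ j.+1) `^ beta)%:E *
      (\1_(cball (0 : 'rV[R]_N) (2^-1 ^+ j * r) : set (Rn R n)) x)%:E))%E.
Proof.
move=> beta0 r0.
have term0 j : (0 <= ((2^-1 ^+ j.+1) `^ beta)%:E *
      (\1_(cball (0 : 'rV[R]_N) (2^-1 ^+ j * r) : set (Rn R n)) x)%:E :> \bar R)%E.
  by rewrite mule_ge0 ?lee_fin ?powR_ge0.
have [rx|xr] := leP r (enorm x).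
  rewrite -[leLHS]adde0; apply: leeD; last exact: nneseries_ge0.
  by rewrite lee_fin powR_le1// ler_pdivlMr// mul1r.
have [x0|x0] := eqVneq (enorm x) 0.
  rewrite x0 mul0r -[leLHS]adde0; apply: leeD; last exact: nneseries_ge0.
  by rewrite lee_fin /powR eqxx; case: (beta == 0); rewrite ?ler01.
have {}x0 : 0 < enorm x by rewrite lt_def x0 enorm_ge0.
have ex : exists j, 2^-1 ^+ j.+1 * r < enorm x.
  exists (Num.bound (r / enorm x)); rewrite exprVn ltr_pdivrMl ?exprn_gt0//.
  rewrite -ltr_pdivrMr//.
  have e0 : 0 <= r / enorm x by rewrite divr_ge0// ltW.
  rewrite (lt_trans (archi_boundP e0))// -natrX ltr_nat.
  by rewrite (leq_trans (ltn_expl _ (isT : (1 < 2)%N)))// leq_exp2l.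
have [j xj jmin] := ex_minnP ex.
have jx : cball (0 : 'rV[R]_N) (2^-1 ^+ j * r) x.
  rewrite /cball/= subr0; case: j xj jmin => [|j] xj jmin; first
      by rewrite expr0 mul1r ltW.
  by rewrite leNgt; apply/negP => /jmin; rewrite ltnn.
rewrite -[leLHS]add0e; apply: leeD; first by rewrite lee_fin.
apply: le_trans (nneseries_ge_term j term0).
rewrite indicE mem_set// mule1 lee_fin.
apply: ge0_ler_powR_neg; [exact: exprn_gt0| |exact: beta0].
by rewrite ler_pdivlMr// ltW.
Qed.

(** The dyadic balls around the origin contribute a geometric series of ratio
    [2 ^ - (beta + N)], which converges as [- N < beta]; the part of the ball at
    a distance at least [r] from the origin contributes at most its volume.  Both
    bounds hold whatever the center [c]. *)
Lemma radial_weight_integral_le (beta : R) : - N%:R < beta -> beta <= 0 ->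
  exists2 C : R, 0 <= C & forall c r, 0 < r ->
    (\int[leb]_(x in cball c r) ((enorm x / r) `^ beta)%:E <=
      (C * ball_vol n r)%:E)%E.
Proof.
move=> betaN beta0; pose h : R := 2^-1.
have h0 : 0 < h by rewrite invr_gt0.
pose z := h `^ beta * h ^+ N.
have z0 : 0 <= z by rewrite mulr_ge0 ?powR_ge0 ?exprn_ge0// ltW.
have z1 : z < 1.
  rewrite /z -powR_mulrn ?ltW// -powRD_gt0// /h powR_inv// powRN.
  have e0 : 0 < beta + N%:R by lra.
  rewrite invf_lt1 ?powR_gt0//.
  have := @gt0_ltr_powR R _ e0 1 2; rewrite powR1; apply; rewrite ?nnegrE//.
  by rewrite ltr1n.
exists (1 + h `^ beta * (1 - z)^-1).
  by rewrite addr_ge0// mulr_ge0 ?powR_ge0// invr_ge0 subr_ge0 ltW.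
move=> c r r0; have mB : measurable (cball c r : set (Rn R n))
    by exact: measurable_cball.
pose B j : set (Rn R n) := cball (0 : 'rV[R]_N) (h ^+ j * r).
have mBj j : measurable (B j) by exact: measurable_cball.
pose T j x := (((h ^+ j.+1) `^ beta)%:E * (\1_(B j) x)%:E)%E.
have mI j : emeas (fun x => (\1_(B j) x)%:E).
  by apply/measurable_EFinP; exact: measurable_indic.
have I0 j x : (0 <= (\1_(B j) x)%:E :> \bar R)%E by rewrite lee_fin.
have mT j : emeas (T j) by exact: emeasurable_funZl.
have T0 j x : (0 <= T j x)%E by rewrite mule_ge0 ?lee_fin ?powR_ge0.
have m1 : emeas (cst 1%:E) by exact: measurable_cst.
have mS : emeas (fun x => \sum_(j <oo) T j x)%E by exact: ge0_emeasurable_sumT.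
have S0 x : (0 <= \sum_(j <oo) T j x)%E by exact: nneseries_ge0.
have mw : emeas (fun x => ((enorm x / r) `^ beta)%:E).
  apply/measurable_EFinP; apply: measurable_fun_powR.
  by apply: measurable_funM; [exact: measurable_enorm|exact: measurable_cst].
apply: (@le_trans _ _ (\int[leb]_(x in cball c r) (1%:E + \sum_(j <oo) T j x))%E).
  apply: ge0_le_integralT; [exact: mB|exact: mw|exact: emeasurable_funD| |].
    by move=> x _; rewrite lee_fin powR_ge0.
  by move=> x _; exact: radial_weight_le.
rewrite ge0_integralDT; [|exact: mB|exact: m1|exact: mS|by []|exact: S0].
rewrite integral_cball_cst// mul1r mulrDl mul1r EFinD; apply: leeD => //.
rewrite integral_nneseriesT; [|exact: mB|exact: mT|exact: T0].
apply: (@le_trans _ _ (\sum_(j <oo) (h `^ beta * ball_vol n r)%:E * (z ^+ j)%:E)%E).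
  apply: lee_nneseries => [j _ _|j _]; first by apply: integral_ge0.
  rewrite /T ge0_integralZlT; [|exact: mB|exact: mI|exact: I0|exact: powR_ge0].
  rewrite integral_indic; [|exact: mB|exact: mBj].
  apply: (@le_trans _ _ (((h ^+ j.+1) `^ beta)%:E * leb (B j))%E).
    apply: lee_wpmul2l; first by rewrite lee_fin powR_ge0.
    by apply: le_measure; rewrite ?inE//; exact: measurableI.
  rewrite leb_cball ?mulr_gt0 ?exprn_gt0// ball_volM -!EFinM lee_fin.
  rewrite powR_exprn ?(ltW h0)// exprS -exprM mulnC exprM /z exprMn.
  rewrite le_eqVlt; apply/orP; left; apply/eqP; ring.
rewrite nneseriesZl; last by move=> j _; rewrite lee_fin exprn_ge0.
by rewrite nneseries_geometric// -EFinM lee_fin mulrAC.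
Qed.

(** Young's inequality with exponents [s / p] and its conjugate [q], after scaling
    the block by its height and the ball to radius 1.  The strict lower bound on
    [alpha] says that [|x| ^ (alpha q)] is integrable at the origin. *)
Lemma nonneg_block_weighted_le (p s alpha : R) : 0 < p -> p < s ->
  - N%:R * (1 - p / s) < alpha -> alpha <= 0 ->
  exists2 C : R, 0 < C & forall c r b,
    nonneg_block s (block_height n p alpha) c r b ->
    (\int[leb]_x (b x `^ p * (enorm x `^ alpha)%:E) <= C%:E)%E.
Proof.
move=> p0 ps alphaN alpha0; have s0 : 0 < s by exact: lt_trans ps.
set theta := block_height n p alpha.
pose d := 1 - p / s; have d0 : 0 < d by rewrite subr_gt0 ltr_pdivrMr// mul1r.
pose q := d^-1; have q0 : 0 < q by rewrite invr_gt0.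
pose beta := alpha * q.
have betaN : - N%:R < beta by rewrite /beta ltr_pdivlMr.
have beta0 : beta <= 0 by rewrite /beta mulr_le0_ge0// ltW.
have [C C0 hC] := radial_weight_integral_le betaN beta0.
pose k := @unit_ball_vol R n `^ (- (alpha / N%:R)).
have k0 : 0 < k by rewrite powR_gt0// unit_ball_vol_gt0.
exists (k * (1 + C)); first by rewrite mulr_gt0// ltr_wpDr.
move=> c r b [r0 mb b0 bc bs].
have v0 : 0 < ball_vol n r by exact: ball_vol_gt0.
pose h := ball_vol n r `^ (- theta).
have h0 : 0 < h by exact: powR_gt0.
pose a := h `^ p * r `^ alpha.
have a0 : 0 < a by rewrite mulr_gt0 ?powR_gt0.
have mB : measurable (cball c r : set (Rn R n)) by exact: measurable_cball.
have mw : emeas (fun x => (enorm x `^ alpha)%:E).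
  by apply/measurable_EFinP; apply: measurable_fun_powR; exact: measurable_enorm.
have mw' : emeas (fun x => ((enorm x / r) `^ beta)%:E).
  apply/measurable_EFinP; apply: measurable_fun_powR.
  by apply: measurable_funM; [exact: measurable_enorm|exact: measurable_cst].
have mbp : emeas (fun x => b x `^ p)%E by exact: measurable_fun_poweR.
have mbs : emeas (fun x => b x `^ s)%E by exact: measurable_fun_poweR.
have mbs' : emeas (fun x => (h `^ (- s))%:E * b x `^ s)%E by exact: emeasurable_funZl.
have bs0 x : (0 <= (h `^ (- s))%:E * b x `^ s)%E.
  by rewrite mule_ge0 ?poweR_ge0// lee_fin powR_ge0.
have w0 x : (0 <= ((enorm x / r) `^ beta)%:E)%E by rewrite lee_fin powR_ge0.
have msum : emeas (fun x => (h `^ (- s))%:E * b x `^ s + ((enorm x / r) `^ beta)%:E)%E.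
  exact: emeasurable_funD.
have -> : (\int[leb]_x (b x `^ p * (enorm x `^ alpha)%:E) =
    \int[leb]_(x in cball c r) (b x `^ p * (enorm x `^ alpha)%:E))%E.
  rewrite [RHS]integral_mkcond; apply: eq_integral => x _; rewrite patchE.
  by case: ifPn => //; rewrite notin_setE => /bc ->; rewrite poweR0r ?gt_eqF// mul0e.
apply: (@le_trans _ _ (\int[leb]_(x in cball c r) (a%:E *
    ((h `^ (- s))%:E * b x `^ s + ((enorm x / r) `^ beta)%:E)))%E).
  apply: ge0_le_integralT; [exact: mB|exact: emeasurable_funM|
      exact: emeasurable_funZl| |].
    by move=> x _; rewrite mule_ge0 ?poweR_ge0// lee_fin powR_ge0.
  move=> x _; case: (b x) (b0 x) => [t| |]// t0; last first.
    rewrite [(+oo `^ s)%E]poweRyr ?gt_eqF// gt0_muley ?lte_fin ?powR_gt0//.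
    by rewrite addye// gt0_muley ?lte_fin// leey.
  rewrite lee_fin in t0; rewrite !poweR_EFin -!EFinM lee_fin.
  set y := enorm x / r.
  have y0 : 0 <= y by rewrite divr_ge0 ?enorm_ge0// ltW.
  have tE : t `^ p = h `^ p * (t / h) `^ p.
    by rewrite -powRM ?divr_ge0 ?(ltW h0)// mulrC divfK ?gt_eqF.
  have xE : enorm x `^ alpha = r `^ alpha * y `^ alpha.
    by rewrite -powRM ?(ltW r0)// /y mulrC divfK ?gt_eqF.
  rewrite tE xE mulrACA -/a; apply: ler_wpM2l; first exact: ltW.
  have sp0 : 0 < s / p by rewrite divr_gt0.
  have conj : (s / p)^-1 + q^-1 = 1 by rewrite invf_div /q invrK /d addrC subrK.
  have := conjugate_powR (powR_ge0 (t / h) p) (powR_ge0 y alpha) sp0 q0 conj.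
  rewrite -[((t / h) `^ p) `^ _]powRrM -[(y `^ alpha) `^ _]powRrM -/beta.
  rewrite (_ : p * (s / p) = s); last by field; rewrite gt_eqF.
  have -> : h `^ (- s) * t `^ s = (t / h) `^ s.
    by rewrite powRM ?invr_ge0 ?(ltW h0)// powR_inv ?(ltW h0)// mulrC.
  move/le_trans; apply; apply: lerD; rewrite ler_piMr ?powR_ge0//.
    by rewrite invf_div ler_pdivrMr// mul1r ltW.
  by rewrite /q invrK /d gerBl divr_ge0// ltW.
rewrite ge0_integralZlT; [|exact: mB|exact: msum|by move=> x; rewrite adde_ge0|
    exact: ltW].
rewrite ge0_integralDT; [|exact: mB|exact: mbs'|exact: mw'|exact: bs0|exact: w0].
rewrite ge0_integralZlT; [|exact: mB|exact: mbs|by move=> x; exact: poweR_ge0|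
    exact: powR_ge0].
apply: (@le_trans _ _ (a%:E * ((ball_vol n r)%:E + (C * ball_vol n r)%:E))%E).
  apply: lee_wpmul2l; first by rewrite lee_fin ltW.
  apply: leeD; last exact: hC.
  apply: (@le_trans _ _ ((h `^ (- s))%:E * (ball_vol n r `^ (1 - theta * s))%:E)%E).
    apply: lee_wpmul2l; first by rewrite lee_fin powR_ge0.
    apply: le_trans bs; apply: ge0_subset_integralT; [exact: mB|exact: measurableT|
        exact: mbs| |by []].
    by move=> x; exact: poweR_ge0.
  rewrite -EFinM lee_fin /h -powRrM -powRD_gt0//.
  rewrite (_ : - theta * - s + (1 - theta * s) = 1); last by ring.
  by rewrite powRr1// ltW.
rewrite -EFinD -EFinM lee_fin -{1}[ball_vol n r]mul1r -mulrDl mulrCA mulrC.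
apply: ler_wpM2r; first by rewrite addr_ge0.
rewrite /a /h -powRrM mulrAC -[X in _ * X * _](powRr1 (ltW v0)) -powRD_gt0//.
rewrite (_ : - theta * p + 1 = - (alpha / N%:R)); last first.
  rewrite /theta /block_height; field.
  by rewrite nat1r pnatr_eq0 (gt_eqF p0).
rewrite /ball_vol powRM ?exprn_ge0 ?(ltW r0)//; last exact: ltW (unit_ball_vol_gt0).
rewrite -/k -mulrA -powR_mulrn ?(ltW r0)// -powRrM -powRD_gt0//.
rewrite (_ : N%:R * _ + alpha = 0) ?powRr0 ?mulr1//.
by field; rewrite nat1r pnatr_eq0.
Qed.

(** For [p <= 1], [t |-> t ^ p] is subadditive; for [1 < p] the series is
    controlled by Jensen's inequality. *)
Lemma nonneg_block_series_weighted_le (p s alpha : R) : 0 < p -> p < s ->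
  - N%:R * (1 - p / s) < alpha -> alpha <= 0 ->
  exists2 C : R, 0 < C & forall f (mu : nat -> R) (c : nat -> 'rV[R]_N)
      (r : nat -> R) (b : nat -> 'rV[R]_N -> \bar R),
    emeas f -> (forall x, 0 <= f x)%E -> (forall k, 0 <= mu k) ->
    (forall k, nonneg_block s (block_height n p alpha) (c k) (r k) (b k)) ->
    (forall x, f x <= \sum_(k <oo) (mu k)%:E * b k x)%E ->
    (weighted_Lnorm p alpha f <=
      C%:E * (\sum_(k <oo) (mu k `^ pbar p)%:E) `^ (pbar p)^-1)%E.
Proof.
move=> p0 ps alphaN alpha0.
have [C C0 hC] := nonneg_block_weighted_le p0 ps alphaN alpha0.
exists (C `^ p^-1); first exact: powR_gt0.
move=> f mu c r b mf f0 mu0 bb fb.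
have mb k : emeas (b k) by case: (bb k).
have b0 k x : (0 <= b k x)%E by case: (bb k).
have mub0 k x : (0 <= (mu k)%:E * b k x)%E by rewrite mule_ge0 ?lee_fin.
pose w x : \bar R := (enorm x `^ alpha)%:E.
have w0 x : (0 <= w x)%E by rewrite lee_fin powR_ge0.
have mw : emeas w.
  by apply/measurable_EFinP; apply: measurable_fun_powR; exact: measurable_enorm.
have mfp : emeas (fun x => f x `^ p)%E by exact: measurable_fun_poweR.
have mbp k : emeas (fun x => b k x `^ p)%E by exact: measurable_fun_poweR.
have mbw k : emeas (fun x => b k x `^ p * w x)%E by exact: emeasurable_funM.
have bw0 k x : (0 <= b k x `^ p * w x)%E by rewrite mule_ge0 ?poweR_ge0.
(* subadditivity and convexity both bound [f ^ p] by a series in the [b k ^ p] *)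
have key (nu : nat -> R) : (forall k, 0 <= nu k) ->
    (forall x, f x `^ p <= \sum_(k <oo) (nu k)%:E * b k x `^ p)%E ->
    (\int[leb]_x (`|f x| `^ p * w x) <= C%:E * \sum_(k <oo) (nu k)%:E)%E.
  move=> nu0 fnu.
  have mnb k : emeas (fun x => (nu k)%:E * (b k x `^ p * w x))%E
      by exact: emeasurable_funZl.
  have nb0 k x : (0 <= (nu k)%:E * (b k x `^ p * w x))%E by rewrite mule_ge0 ?lee_fin.
  apply: (@le_trans _ _ (\int[leb]_x \sum_(k <oo) (nu k)%:E * (b k x `^ p * w x))%E).
    apply: ge0_le_integralT; [exact: measurableT| |exact: ge0_emeasurable_sumT| |].
    - apply: emeasurable_funM; last exact: mw.
      by apply: measurable_fun_poweR; exact: measurable_fun_abse.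
    - by move=> x _; rewrite mule_ge0 ?poweR_ge0.
    move=> x _; rewrite gee0_abs//.
    apply: (@le_trans _ _ (w x * \sum_(k <oo) (nu k)%:E * b k x `^ p)%E).
      by rewrite muleC; apply: lee_wpmul2l.
    rewrite /w -nneseriesZl; last by move=> k _; rewrite mule_ge0 ?lee_fin ?poweR_ge0.
    by under eq_eseriesr do rewrite muleCA [((_ `^ alpha)%:E * _)%E]muleC.
  rewrite integral_nneseriesT; [|exact: measurableT|exact: mnb|exact: nb0].
  rewrite -nneseriesZl; last by move=> k _; rewrite lee_fin.
  apply: lee_nneseries => [k _ _|k _]; first by apply: integral_ge0.
  rewrite ge0_integralZlT; [|exact: measurableT|exact: mbw|exact: bw0|exact: nu0].
  by rewrite muleC; apply: lee_wpmul2r; [rewrite lee_fin|exact: hC (bb k)].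
have smu0 (e : R) : (0 <= \sum_(k <oo) (mu k `^ e)%:E)%E.
  by apply: nneseries_ge0 => k _ _; rewrite lee_fin powR_ge0.
have int0 : (0 <= \int[leb]_x (`|f x| `^ p * w x))%E.
  by apply: integral_ge0 => x _; rewrite mule_ge0 ?poweR_ge0.
have pV0 : 0 <= p^-1 by rewrite invr_ge0 ltW.
have [p1|p1] := leP p 1.
  have -> : pbar p = p by rewrite /pbar min_l.
  rewrite -poweR_EFin -poweRM// ?lee_fin ?(ltW C0)//; apply: le_poweR => //.
  apply: key => [k|x]; first exact: powR_ge0.
  apply: (@le_trans _ _ ((\sum_(k <oo) (mu k)%:E * b k x) `^ p)%E).
    by apply: le_poweR; rewrite ?(ltW p0).
  have := @nneseries_le_powR _ p (fun k => (mu k)%:E * b k x)%E p0 p1 (mub0^~ x).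
  have S0 : (0 <= \sum_(k <oo) (mu k)%:E * b k x)%E by exact: nneseries_ge0.
  move/(le_poweR (ltW p0) S0).
  rewrite -poweRrM mulVf ?gt_eqF// poweRe1; last first.
    by apply: nneseries_ge0 => k _ _; exact: poweR_ge0.
  by under [X in (_ <= X)%E -> _]eq_eseriesr do rewrite poweRM ?lee_fin// poweR_EFin.
have -> : pbar p = 1 by rewrite /pbar min_r// ltW.
rewrite invr1 poweRe1//; under [in leRHS]eq_eseriesr do rewrite powRr1//.
have sm0 : (0 <= \sum_(k <oo) (mu k)%:E)%E by apply: nneseries_ge0 => k _ _;
    rewrite lee_fin.
case muL : (\sum_(k <oo) (mu k)%:E)%E sm0 => [L| |]// L0; last first.
  by rewrite gt0_muley ?leey// lte_fin powR_gt0.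
rewrite lee_fin in L0.
have -> : ((C `^ p^-1)%:E * L%:E = (C%:E * (L `^ p)%:E) `^ p^-1)%E.
  rewrite poweRM ?lee_fin ?powR_ge0 ?(ltW C0)// !poweR_EFin -powRrM.
  by rewrite divff ?gt_eqF// powRr1.
apply: le_poweR => //.
apply: le_trans (key (fun k => L `^ (p - 1) * mu k) _ _) _.
- by move=> k; rewrite mulr_ge0 ?powR_ge0.
- move=> x; apply: (@le_trans _ _ ((\sum_(k <oo) (mu k)%:E * b k x) `^ p)%E).
    by apply: le_poweR; rewrite ?(ltW p0).
  apply: le_trans (nneseries_jensen p1 mu0 (b0^~ x) muL) _.
  rewrite -nneseriesZl; last by move=> k _; rewrite mule_ge0 ?lee_fin ?poweR_ge0.
  by under [in leRHS]eq_eseriesr do rewrite EFinM -muleA.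
apply: lee_wpmul2l; first by rewrite lee_fin ltW.
under eq_eseriesr do rewrite EFinM.
rewrite nneseriesZl; last by move=> k _; rewrite lee_fin.
by rewrite muL -EFinM lee_fin mulrC mulr_powRB1.
Qed.

End weighted_embedding.

(** * Boundedness on block spaces *)

Section boundedness.
Context {R : realType} {n : nat}.
Implicit Types (f : 'rV[R]_n.+1 -> \bar R).
Local Notation N := n.+1.

Lemma block_height_lt1 (p alpha : R) : 0 < p -> alpha < N%:R * (p - 1) ->
  block_height n p alpha < 1.
Proof.
move=> p0 alphap; have pN0 : 0 < p * N%:R by rewrite mulr_gt0 ?ltr0n.
rewrite /block_height -(ltr_pM2r pN0) mulrDl mul1r divfK ?gt_eqF//.
by rewrite mulrA mulVf ?gt_eqF// mul1r; lra.
Qed.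

Lemma block_height_ge (p s alpha : R) : 0 < p -> 0 < s ->
  - N%:R * (1 - p / s) <= alpha -> s^-1 <= block_height n p alpha.
Proof.
move=> p0 s0 alphap; have pN0 : 0 < p * N%:R by rewrite mulr_gt0 ?ltr0n.
rewrite /block_height -(ler_pM2r pN0) mulrDl divfK ?gt_eqF//.
by rewrite [p^-1 * _]mulrA mulVf ?gt_eqF// mul1r mulrA [s^-1 * p]mulrC; lra.
Qed.

Lemma lee_ereal_infZl (k : R) (z : \bar R) (S : set (\bar R)) : 0 < k ->
  (forall y, S y -> z <= k%:E * y)%E -> (z <= k%:E * ereal_inf S)%E.
Proof.
move=> k0 h; rewrite -lee_pdivrMl//; apply: le_ereal_inf_tmp => y /h.
by rewrite lee_pdivrMl.
Qed.

(** It suffices to bound a functional of [f] in terms of the coefficients of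
    the series that dominates [HL_max f]. *)
Lemma BLnorm_bound (p s alpha : R) (z : ('rV[R]_n.+1 -> \bar R) -> \bar R) (C : R) :
  0 < p -> 1 < s -> block_height n p alpha < 1 -> 0 < C ->
  (forall f lam a, block_decomposition p s%:E alpha f lam a ->
    forall (mu : nat -> R) (c : nat -> 'rV[R]_N) (r : nat -> R)
      (B : nat -> 'rV[R]_N -> \bar R),
    (forall k, 0 <= mu k) ->
    (forall k, nonneg_block s (block_height n p alpha) (c k) (r k) (B k)) ->
    (\sum_(k <oo) (mu k `^ pbar p)%:E < +oo)%E ->
    (forall x, HL_max f x <= \sum_(k <oo) (mu k)%:E * B k x)%E ->
    (z f <= C%:E * (\sum_(k <oo) (mu k `^ pbar p)%:E) `^ (pbar p)^-1)%E) ->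
  exists C' : R, forall f, BL p s%:E alpha f ->
    (z f <= C'%:E * BLnorm p s%:E alpha f)%E.
Proof.
move=> p0 s1 th1 C0 hz; have [A A0 hA] := HL_max_block_series p0 s1 th1.
exists (C * A `^ (pbar p)^-1) => f _; apply: lee_ereal_infZl.
  by rewrite mulr_gt0 ?powR_gt0.
move=> _ [lam [a [fa ->]]]; have [mu [c [r [B [mu0 hB muA fB]]]]] := hA f lam a fa.
have [_ lamfin _] := fa.
have S0 : (0 <= \sum_(k <oo) (`|lam k| `^ pbar p)%:E)%E.
  by apply: nneseries_ge0 => k _ _; rewrite lee_fin powR_ge0.
have mufin : (\sum_(k <oo) (mu k `^ pbar p)%:E < +oo)%E.
  by rewrite muA lte_mul_pinfty// lee_fin ltW.
apply: le_trans (hz f lam a fa mu c r B mu0 hB mufin fB) _.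
rewrite muA poweRM//; last by rewrite lee_fin ltW.
by rewrite poweR_EFin muleA -EFinM.
Qed.

End boundedness.

Theorem theorem4p4 (R : realType) (n : nat) (p s alpha : R) :
  (1 < s -> 0 < p -> p <= s ->
   - n.+1%:R * (1 - p / s) <= alpha -> alpha < n.+1%:R * (p - 1) ->
   exists C : R, forall f : 'rV[R]_n.+1 -> \bar R,
     BL p s%:E alpha f ->
     (BLnorm p s%:E alpha (HL_max f) <= C%:E * BLnorm p s%:E alpha f)%E)
  /\
  (1 < s -> 0 < p -> p < s ->
   - n.+1%:R * (1 - p / s) < alpha -> alpha < n.+1%:R * (p - 1) ->
   alpha <= 0 ->
   exists C : R, forall f : 'rV[R]_n.+1 -> \bar R,
     BL p s%:E alpha f ->
     (weighted_Lnorm p alpha (HL_max f) <= C%:E * BLnorm p s%:E alpha f)%E).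
Proof.
split=> [s1 p0 _ alpha_ge alpha_lt|s1 p0 ps alpha_gt alpha_lt alpha0].
  have s0 : 0 < s by exact: lt_trans s1.
  have th1 := block_height_lt1 p0 alpha_lt.
  apply: (@BLnorm_bound _ _ _ _ _ (fun f => BLnorm p s%:E alpha (HL_max f))
      1 p0 s1 th1 ltr01).
  move=> f lam a fa mu c r B mu0 hB mufin fB; rewrite mul1e.
  have [a' ha'] := block_decomposition_dominated p0 s1
    (block_height_ge p0 s0 alpha_ge) (ltW th1) mu0 mufin hB
    (measurable_HL_max (measurable_block_series fa)) (HL_max_ge0 f) fB.
  apply: ereal_inf_lbound; exists mu, a'; split=> //.
  by congr (_ `^ _)%E; apply: eq_eseriesr => k _; rewrite ger0_norm.
have th1 := block_height_lt1 p0 alpha_lt.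
have [C C0 hC] := nonneg_block_series_weighted_le p0 ps alpha_gt alpha0.
apply: (@BLnorm_bound _ _ _ _ _ (fun f => weighted_Lnorm p alpha (HL_max f))
    C p0 s1 th1 C0).
move=> f lam a fa mu c r B mu0 hB _ fB.
apply: (hC _ mu c r B); [|exact: HL_max_ge0|exact: mu0|exact: hB|exact: fB].
exact: measurable_HL_max (measurable_block_series fa).
Qed.
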